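(* There exist absolute constants $C>0$ and $c>0$ such that for all integers $d\ge1$, $1\le s\le cd$, all $\sigma>0$, any $\boldsymbol\theta\in B_0(s,d)$ and any $\boldsymbol\Sigma$ satisfying Assumption $(\varepsilon^*1)$, \[ \mathbf E_{\boldsymbol\theta,\boldsymbol\Sigma}\left[\frac{|\hat\sigma_D^2-\sigma^2|}{\sigma^2}\right]\le C\left(\frac{s}{d\,(1\vee\log(s/\|\tilde{\boldsymbol\Sigma}\|_F))}+\frac{\|\tilde{\boldsymbol\Sigma}\|_F}{d}\right). \]
   Context: Model: one observes $\boldsymbol Y=\boldsymbol\theta+\sigma\boldsymbol\varepsilon\in\mathbb R^d$, $\boldsymbol\varepsilon\sim\mathcal N(\boldsymbol0,\boldsymbol\Sigma)$, $\boldsymbol\Sigma$ a covariance matrix with known diagonal entries $\sigma_i^2$, $\sigma>0$ unknown; $\mathbf E_{\boldsymbol\theta,\boldsymbol\Sigma}$ is the expectation under this model. $B_0(s,d)=\{\boldsymbol\theta:\|\boldsymbol\theta\|_0\le s\}$. Assumption $(\varepsilon^*1)$: $\min_i\sigma_i^2\ge c_*$ for a constant $c_*>0$. $\tilde Y_i=Y_i/\sigma_i$, $\tilde{\boldsymbol\Sigma}_{ij}=\boldsymbol\Sigma_{ij}/(\sigma_i\sigma_j)$. $\hat F_{Y^2}$ is the empirical c.d.f. of $\tilde Y_1^2,\dots,\tilde Y_d^2$, $F$ the c.d.f. of $\chi^2_1$; $\hat\sigma_S^2(t)=t/F^{-1}(\hat F_{Y^2}(t))$ if $\hat F_{Y^2}(t)>0$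 and $+\infty$ otherwise; $\hat t=\min\{2^\ell:\ell\in\mathbb Z,\ \hat F_{Y^2}(2^\ell)\ge0.5\}$; $\hat\sigma_S^2=\hat\sigma_S^2(\hat t)$. Let $\hat\varphi_d(u)=\frac1d\sum_{i=1}^d\cos(u\tilde Y_i)$, $\lambda=\frac{1\vee\log(s/\|\tilde{\boldsymbol\Sigma}\|_F)}{6}$, $\tilde\sigma_D^2=-\frac{2\hat t}{\lambda}\log\big|\hat\varphi_d(\sqrt{\lambda/\hat t})\big|$, and $\hat\sigma_D^2=\min\{\tilde\sigma_D^2,2\hat\sigma_S^2\}$. *)

(* Defs.v *)
From HB Require Import structures.
From mathcomp Require Import all_boot all_order all_algebra.
From mathcomp Require Import all_classical all_reals all_analysis.
Set Implicit Arguments. Unset Strict Implicit. Unset Printing Implicit Defensive.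
Import Order.TTheory GRing.Theory Num.Theory.
Import numFieldNormedType.Exports.
Local Open Scope classical_set_scope.
Local Open Scope ring_scope.

Section defs.
Context {R : realType}.

(* Mutual independence of a finite family of real random variables:
   product rule for every family of Borel sets (taking B i = setT
   recovers every subfamily). *)
Definition mutually_independent {dT} {T : measurableType dT}
  (P : probability T R) (n : nat) (Z : 'I_n -> T -> R) : Prop :=
  forall B : 'I_n -> set R, (forall i, measurable (B i)) ->
    P (\bigcap_(i in [set: 'I_n]) (Z i @^-1` B i)) =
    (\prod_(i < n) P (Z i @^-1` B i))%E.

Definition chi2_1_cdf (x : R) : R :=
  fine (normal_prob 0 1 [set z : R | z ^+ 2 <= x]).

(* generalized inverse F^{-1}(p) = inf {x | F x >= p} (used for 0 < p < 1) *)
Definition chi2_1_quantile (p : R) : R := inf [set x : R | p <= chi2_1_cdf x].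

Definition Fhat (d : nat) (Yt : 'I_d -> R) (t : R) : R :=
  #|[set i : 'I_d | Yt i ^+ 2 <= t]|%:R / d%:R.

Definition t_hat (d : nat) (Yt : 'I_d -> R) : R :=
  inf [set x : R | exists l : int, x = 2 ^ l /\ 2^-1 <= Fhat Yt x].

(* sigma_S^2(t) = t / F^{-1}(Fhat t) if Fhat t > 0, +oo otherwise
   (with F^{-1}(1) = +oo, hence t / F^{-1}(1) = 0) *)
Definition sigmaS2 (d : nat) (Yt : 'I_d -> R) (t : R) : \bar R :=
  if Fhat Yt t == 0 then +oo%E
  else if Fhat Yt t == 1 then 0%E
  else (t / chi2_1_quantile (Fhat Yt t))%:E.

Definition sigmaS2_hat (d : nat) (Yt : 'I_d -> R) : \bar R :=
  sigmaS2 Yt (t_hat Yt).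

Definition phi_hat (d : nat) (Yt : 'I_d -> R) (u : R) : R :=
  (\sum_(i < d) cos (u * Yt i)) / d%:R.

Definition lambda_D (s : nat) (froSigma : R) : R :=
  Num.max 1 (ln (s%:R / froSigma)) / 6.

(* sigma~_D^2 = -(2 t_hat / lambda) log |phi_hat(sqrt(lambda / t_hat))|
   (= +oo when phi_hat vanishes, since log 0 = -oo) *)
Definition sigmaD2_tilde (d s : nat) (froSigma : R) (Yt : 'I_d -> R) : \bar R :=
  let t := t_hat Yt in
  let lam := lambda_D s froSigma in
  let ph := phi_hat Yt (Num.sqrt (lam / t)) in
  if ph == 0 then +oo%E else (- (2 * t / lam) * ln `|ph|)%:E.

Definition sigmaD2_hat (d s : nat) (froSigma : R) (Yt : 'I_d -> R) : \bar R :=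
  Order.min (sigmaD2_tilde s froSigma Yt) (2%:E * sigmaS2_hat Yt)%E.

Definition normalized_frob (d : nat) (Sigma : 'M[R]_d) : R :=
  Num.sqrt (\sum_(i < d) \sum_(j < d)
     (Sigma i j / (Num.sqrt (Sigma i i) * Num.sqrt (Sigma j j))) ^+ 2).

End defs.

(* Main.v *)
Require Import Defs.
From HB Require Import structures.
From mathcomp Require Import all_boot all_order all_algebra.
From mathcomp Require Import all_classical all_reals all_analysis.
From mathcomp Require Import measurable_realfun ring lra.
Set Implicit Arguments.
Unset Strict Implicit.
Unset Printing Implicit Defensive.
Import Order.TTheory GRing.Theory Num.Theory.
Import numFieldNormedType.Exports.
Local Open Scope classical_set_scope.
Local Open Scope ring_scope.

(** Every moment needed is a Gaussian characteristic function:
    E cos(b + x xi_i + y xi_k) = cos b * exp(- (x^2 + y^2 + 2 x y rho_ik) / 2).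
    It makes the empirical characteristic function of the noise have variance
    of order v^2 F^2 / d^2 on the unperturbed coordinates (with v = u^2 sigma^2
    and F the Frobenius norm of the correlations), the s perturbed coordinates
    adding at most v s F / d^2 and a relative bias of order s / d.  The same
    formula controls the mean of xi_i^2 (by Fatou) and the empirical c.d.f. of
    xi_i^2, whose indicators are dominated by polynomials in cos(u x).

    Hence, outside events whose indicators are dominated by squares of mean
    O(F^2 / d^2), t_hat is one of seven dyadic numbers in
    [3/16 sigma^2, 16 sigma^2] and 2 sigma_S^2 >= sigma^2, so that the
    truncation is harmless and the error is read off the logarithm of the
    empirical characteristic function.  On the bad events
    0 <= sigma_D^2 <= 10 t_hat, and t_hat is at most 8 sigma^2 times the mean
    of the xi_i^2.  The whole bound is a pointwise domination by a measurable
    function, so measurability of the estimator plays no role. *)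

(** Dividing the empirical characteristic function by its mean exp(-v/2) multiplies its variance by
    exp(v). As s/F = exp(L) when L > 1, the rate s/(d L) tolerates an amplification close to exp(L)
    up to powers of L. The factor 1/6 in lambda and the lower end 3/16 sigma^2 for [t_hat] give v <=
    8L/9, and the spare exp(L/9) absorbs the powers of L.

    Indicators of xi_i^2 <= y have no closed covariance formula, hence the trigonometric majorants.
    One-sided control is enough: only an excess of small xi_i^2 is harmful, and the factor 2 in 2
    sigma_S^2 leaves room between the levels y and 2y. Large xi_i^2 are handled by Markov's
    inequality.

    The estimator evaluates the characteristic function at a frequency that depends on the same
    data; a finite list of deterministic frequencies removes this dependence. A first moment E|D| is
    never computed: |D| <= r + D^2/r, with r the target rate, reduces it to a second moment. *)

(** * Change of variables for a weighted measure *)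

Section weighted_transfer.
Context d d' (T : measurableType d) (T' : measurableType d') (R : realType).
Variables (mu : {measure set T -> \bar R}) (nu : {measure set T' -> \bar R}).
Variables (W : T -> R) (Z : T -> T').
Hypotheses (mW : measurable_fun setT W) (W0 : forall x, 0 <= W x).
Hypothesis mZ : measurable_fun setT Z.
Hypothesis WZ : forall B : set T', measurable B ->
  (\int[mu]_x (W x * \1_B (Z x))%:E = nu B)%E.

Import HBNNSimple.

(** This serves two situations: [W] a density and [Z] the identity, or [W] a function of some
    coordinates and [Z] a coordinate independent of them. Both sides are monotone limits along the
    same simple functions. *)
Lemma ge0_integral_weighted_transfer (f : T' -> R) :
  measurable_fun setT f -> (forall y, 0 <= f y) ->
  (\int[mu]_x (W x * f (Z x))%:E = \int[nu]_y (f y)%:E)%E.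
Proof.
move=> mf f0.
have mfE : measurable_fun setT (EFin \o f) by exact/measurable_EFinP.
pose f_ := nnsfun_approx measurableT mfE.
have f_cvg y : ((f_ n y)%:E @[n --> \oo] --> (f y)%:E)%E.
  by apply: cvg_nnsfun_approx => // z _; rewrite lee_fin.
have f_nd y : {homo (fun n => f_ n y) : m n / (m <= n)%N >-> m <= n}.
  by move=> m n mn; exact/lefP/nd_nnsfun_approx.
have mfZ n : measurable_fun setT (fun x => W x * f_ n (Z x)).
  by apply: measurable_funM => //; exact: measurableT_comp.
transitivity (limn (fun n => \int[nu]_y (f_ n y)%:E)%E); last first.
  rewrite -monotone_convergence//.
  - by apply: eq_integral => y _; apply/cvg_lim => //.
  - by move=> n; exact/measurable_EFinP/measurable_funP.
  - by move=> n y _; rewrite lee_fin.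
  - by move=> y _ m n mn; rewrite lee_fin; exact: f_nd.
rewrite [X in limn X](_ : _ =
    (fun n => \int[mu]_x (W x * f_ n (Z x))%:E)%E).
  rewrite -monotone_convergence//; last 3 first.
  - by move=> n; exact/measurable_EFinP.
  - by move=> n x _; rewrite lee_fin mulr_ge0.
  - by move=> x _ m n mn; rewrite lee_fin ler_wpM2l//; exact: f_nd.
  apply: eq_integral => x _; apply/esym/cvg_lim => //.
  under eq_fun do rewrite EFinM.
  by rewrite EFinM; apply: cvgeZl => //; exact: f_cvg.
apply/funext => n.
have mpre k : measurable (f_ n @^-1` [set k]).
  by rewrite -(setTI (_ @^-1` _)); exact: (measurable_funP (f_ n)).
transitivity (\sum_(k \in range (f_ n)) k%:E * nu (f_ n @^-1` [set k]))%E.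
  under eq_integral do rewrite fimfunE -fsumEFin//.
  rewrite ge0_integral_fsum//; last 2 first.
  - by move=> y; exact/measurable_EFinP/measurable_funM.
  - by move=> y x _; rewrite nnfun_muleindic_ge0.
  apply: eq_fsbigr => r _; rewrite integralZl_indic_nnsfun// integral_indic//=.
  by rewrite setIT.
have step k : k \in range (f_ n) ->
   (k%:E * nu (f_ n @^-1` [set k]) =
   \int[mu]_x (k * (W x * \1_(f_ n @^-1` [set k]) (Z x)))%:E)%E.
  move=> /set_mem[y _ <-].
  under eq_integral do rewrite EFinM.
  rewrite ge0_integralZl ?WZ//.
  - by apply/measurable_EFinP/measurable_funM => //; exact: measurableT_comp.
  - by move=> x _; rewrite lee_fin mulr_ge0.
  - by rewrite lee_fin.
rewrite (eq_fsbigr _ _ step) -ge0_integral_fsum//.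
- apply: eq_integral => x _; rewrite fsumEFin//; congr EFin.
  rewrite (fimfunE (f_ n) (Z x)) mulr_fsumr//.
  by apply: eq_fsbigr => k _; ring.
- move=> k; apply/measurable_EFinP/measurable_funM => //.
  by apply: measurable_funM => //; exact: measurableT_comp.
- move=> k x _; rewrite lee_fin mulrCA mulr_ge0//.
  have := nnfun_muleindic_ge0 (f_ n) k (Z x); rewrite lee_fin; exact.
Qed.

End weighted_transfer.

(** * Bounded measurable functions *)

Section bounded_measurable.
Context d (T : measurableType d) (R : realType).
Implicit Types f g : T -> R.

Definition bounded_measurable f :=
  measurable_fun setT f /\ exists M : R, forall x, `|f x| <= M.

Lemma bounded_measurable_cst r : bounded_measurable (cst r).
Proof. by split => //; exists `|r| => x. Qed.

Lemma bounded_measurableD f g : bounded_measurable f -> bounded_measurable g ->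
  bounded_measurable (fun x => f x + g x).
Proof.
move=> [mf [M fM]] [mg [N gN]]; split; first exact: measurable_funD.
by exists (M + N) => x; rewrite (le_trans (ler_normD _ _)) ?lerD.
Qed.

Lemma bounded_measurableM f g : bounded_measurable f -> bounded_measurable g ->
  bounded_measurable (fun x => f x * g x).
Proof.
move=> [mf [M fM]] [mg [N gN]]; split; first exact: measurable_funM.
by exists (M * N) => x; rewrite normrM ler_pM.
Qed.

Lemma bounded_measurableB f g : bounded_measurable f -> bounded_measurable g ->
  bounded_measurable (fun x => f x - g x).
Proof.
move=> bf bg; under eq_fun do rewrite -mulN1r.
apply: bounded_measurableD => //.
by apply: bounded_measurableM => //; exact: bounded_measurable_cst.
Qed.

Lemma bounded_measurable_sum I (r : seq I) (F : I -> T -> R) :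
  (forall i, bounded_measurable (F i)) ->
  bounded_measurable (fun x => \sum_(i <- r) F i x).
Proof.
move=> bF; elim: r => [|i r IH].
  by under eq_fun do rewrite big_nil; exact: bounded_measurable_cst.
by under eq_fun do rewrite big_cons; exact: bounded_measurableD.
Qed.

Lemma bounded_measurable_cos f : measurable_fun setT f ->
  bounded_measurable (fun x => cos (f x)).
Proof.
move=> mf; split; last by exists 1 => x; exact: cos_max.
by apply: measurableT_comp mf => //; apply: continuous_measurable_fun; exact: continuous_cos.
Qed.

Lemma bounded_measurable_indic (A : set T) : measurable A ->
  bounded_measurable (\1_A : T -> R).
Proof.
move=> mA; split; first exact: measurable_indic.
by exists 1 => x; rewrite indicE ger0_norm// lern1 leq_b1.
Qed.

Lemma bounded_measurable_integrable (P : probability T R) f :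
  bounded_measurable f -> P.-integrable setT (EFin \o f).
Proof.
move=> [mf [M fM]]; apply: measurable_bounded_integrable => //.
  by rewrite (le_lt_trans (probability_le1 P _)) ?ltry.
exists M; split; first exact: num_real.
by move=> x Mx y _; exact: le_trans (fM y) (ltW Mx).
Qed.

Lemma Rintegral_bounded_sum (P : probability T R) I (r : seq I) (F : I -> T -> R) :
  (forall i, bounded_measurable (F i)) ->
  \int[P]_x (\sum_(i <- r) F i x) = \sum_(i <- r) \int[P]_x F i x.
Proof.
move=> bF; elim: r => [|i r IH].
  by under eq_Rintegral do rewrite big_nil; rewrite Rintegral_cst// mul0r big_nil.
under eq_Rintegral do rewrite big_cons.
rewrite big_cons RintegralD ?IH//; apply: bounded_measurable_integrable => //.
exact: bounded_measurable_sum.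
Qed.

End bounded_measurable.

(** * Monotonicity of the integral for a non-measurable integrand *)

Section integral_lower.
Context d (T : measurableType d) (R : realType) (mu : {measure set T -> \bar R}).
Import HBNNSimple.
Local Open Scope ereal_scope.

(* [f] need not be measurable: its integral is a supremum over simple functions. *)
Lemma integral_le_measurable (f g : T -> \bar R) :
  (forall x, 0 <= f x) -> (forall x, f x <= g x) -> measurable_fun setT g ->
  \int[mu]_x f x <= \int[mu]_x g x.
Proof.
move=> f0 fg mg; have g0 x : 0 <= g x by exact: le_trans (fg x).
rewrite [leLHS]ge0_integralTE//; apply: ge_ereal_sup => _ [h /= hf <-].
rewrite -integralT_nnsfun; apply: ge0_le_integral => //.
- by move=> x _; rewrite lee_fin.
- exact/measurable_EFinP.
- by move=> x _; exact: le_trans (hf x) (fg x).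
Qed.

End integral_lower.

(** * Change of variables for signed bounded functions *)

Section transfer.
Context d d' (T : measurableType d) (T' : measurableType d') (R : realType).
Variables (mu : {measure set T -> \bar R}) (nu : probability T' R).
Variables (W : T -> R) (Z : T -> T') (c : R).
Hypotheses (iW : mu.-integrable setT (EFin \o W)) (W0 : forall x, 0 <= W x).
Hypothesis mZ : measurable_fun setT Z.
Hypothesis WZ : forall B : set T', measurable B ->
  \int[mu]_x (W x * \1_B (Z x)) = c * fine (nu B).

Let mW : measurable_fun setT W.
Proof. by case/integrableP : iW => /measurable_EFinP. Qed.

Let integrableWM (f : T' -> R) : bounded_measurable f ->
  mu.-integrable setT (fun x => (W x * f (Z x))%:E).
Proof.
move=> [mf [M fM]].
have iMW := integrableZl measurableT M iW.
apply: le_integrable iMW => //.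
  by apply/measurable_EFinP/measurable_funM => //; exact: measurableT_comp.
move=> x _; rewrite /= lee_fin normrM mulrC normrM.
by rewrite ler_wpM2r// (le_trans (fM _))// ler_norm.
Qed.

Let EFin_WZ B : measurable B ->
  (\int[mu]_x (W x * \1_B (Z x))%:E)%E = (c * fine (nu B))%:E.
Proof.
move=> mB; rewrite -WZ// /Rintegral fineK//.
by apply: integrable_fin_num => //; apply: integrableWM; exact: bounded_measurable_indic.
Qed.

Let c0 : 0 <= c.
Proof.
have := WZ measurableT; rewrite probability_setT/= mulr1 => <-.
by apply: Rintegral_ge0 => x _; rewrite mulr_ge0.
Qed.

Let transfer_ge0 (f : T' -> R) : bounded_measurable f -> (forall y, 0 <= f y) ->
  \int[mu]_x (W x * f (Z x)) = c * \int[nu]_y f y.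
Proof.
move=> bf f0; have mf := bf.1.
have bnu := bounded_measurable_integrable nu bf.
rewrite /Rintegral (@ge0_integral_weighted_transfer _ _ _ _ _ mu
  (mscale (NngNum c0) nu) W Z)//.
  rewrite ge0_integral_mscale//=.
  - by rewrite fineM//; exact: integrable_fin_num bnu.
  - exact/measurable_EFinP.
  - by move=> x _; rewrite lee_fin.
move=> B mB; rewrite EFin_WZ// /mscale/= EFinM fineK//.
exact: fin_num_measure.
Qed.

(** Adding a bound [M] of [|f|] makes the function nonnegative; the constant [M] falls under the
    nonnegative case too and cancels. *)
Lemma Rintegral_weighted_transfer (f : T' -> R) : bounded_measurable f ->
  \int[mu]_x (W x * f (Z x)) = c * \int[nu]_y f y.
Proof.
move=> bf; have [M fM] := bf.2.
have bc : bounded_measurable (fun _ : T' => M) by exact: bounded_measurable_cst.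
have M0 (y : T') : 0 <= M by exact: le_trans (normr_ge0 _) (fM y).
have fM0 y : 0 <= f y + M.
  by have := fM y; rewrite ler_norml => /andP[+ _]; rewrite -subr_ge0 opprK addrC.
have := transfer_ge0 (bounded_measurableD bf bc) fM0.
rewrite RintegralD//; [|exact: bounded_measurable_integrable..].
have -> : \int[mu]_x (W x * (f (Z x) + M)) =
    \int[mu]_x (W x * f (Z x)) + \int[mu]_x (W x * M).
  rewrite -RintegralD//; [|exact: integrableWM..].
  by apply: eq_Rintegral => x _; rewrite mulrDr.
rewrite (transfer_ge0 bc M0) mulrDr => /addIr; exact.
Qed.

End transfer.

(** * Cosine transform of the standard normal law *)

Section normal_charfun.
Variable R : realType.
Local Notation mu := (@lebesgue_measure R).
Local Notation pdf := (@normal_pdf R 0 1).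
Local Notation N01 := (@normal_prob R 0 1).
Implicit Types u x y : R.
Variable c : R.

Let pdfE : pdf = (fun x => normal_peak 1 * expR (- x ^+ 2 / 2)).
Proof.
rewrite normal_pdfE ?oner_eq0//; apply/funext => x.
by rewrite /normal_fun subr0 expr1n.
Qed.

Let pdf_ge0 x : 0 <= pdf x. Proof. exact: normal_pdf_ge0. Qed.

Let measurable_pdf : measurable_fun setT pdf. Proof. exact: measurable_normal_pdf. Qed.

Lemma Rintegral_normal_prob01 (f : R -> R) : bounded_measurable f ->
  \int[N01]_x f x = \int[mu]_x (pdf x * f x).
Proof.
move=> bf; rewrite -[LHS]mul1r.
rewrite -(@Rintegral_weighted_transfer _ _ _ _ R mu N01 pdf id 1)//.
- exact: integrable_normal_pdf.
- move=> B mB; rewrite mul1r /Rintegral; congr fine.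
  transitivity (\int[mu]_(x in B) (pdf x)%:E)%E => //.
  rewrite [RHS]integral_mkcond; apply: eq_integral => x _; rewrite patchE indicE.
  by case: ifP => _; rewrite ?mulr1 ?mulr0.
Qed.

Let integrable_pdfM (f : R -> R) : bounded_measurable f ->
  mu.-integrable setT (EFin \o (fun x => f x * pdf x)).
Proof.
move=> [mf [M fM]].
have iM := integrableZl measurableT M (@integrable_normal_pdf R 0 1).
apply: le_integrable iM => //.
  by apply/measurable_EFinP/measurable_funM.
move=> x _; rewrite /= lee_fin normrM normrM.
by rewrite ler_wpM2r// (le_trans (fM _))// ler_norm.
Qed.

(** The exponent is 3/8 = 1/2 - 1/8: multiplied by exp(-x^2/2) it leaves, up to a constant, the
    normal density of standard deviation 2, which makes [|x| * pdf x] integrable. *)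
Let norm_le_exp x : `|x| <= 2 * expR (3 * x ^+ 2 / 8).
Proof.
apply: (@le_trans _ _ (2 * (1 + 3 * x ^+ 2 / 8))).
  by have [x0|x0] := ger0P x; nra.
by rewrite ler_pM2l ?expR_ge1Dx.
Qed.

Let integrable_norm_pdf : mu.-integrable setT (EFin \o (fun x => `|x| * pdf x)).
Proof.
pose K := 2 * normal_peak 1 / normal_peak 2 : R.
have p2 : 0 < normal_peak 2 :> R by rewrite normal_peak_gt0.
have K0 : 0 <= K by rewrite divr_ge0 ?mulr_ge0 ?normal_peak_ge0.
have iM := integrableZl measurableT K (@integrable_normal_pdf R 0 2).
apply: le_integrable iM => //.
  exact/measurable_EFinP/measurable_funM.
move=> x _; rewrite /= lee_fin normrM normr_id (ger0_norm (pdf_ge0 x)).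
rewrite [leRHS]ger0_norm; last by rewrite mulr_ge0 ?normal_pdf_ge0.
rewrite pdfE normal_pdfE ?pnatr_eq0// /normal_fun subr0 /K.
rewrite [leRHS](_ : _ = normal_peak 1 * (2 * expR (- x ^+ 2 / (2 ^+ 2 *+ 2)))); last first.
  by field; rewrite gt_eqF.
rewrite mulrCA ler_wpM2l ?normal_peak_ge0//.
rewrite (_ : - x ^+ 2 / (2 ^+ 2 *+ 2) = 3 * x ^+ 2 / 8 + - x ^+ 2 / 2); last by field.
by rewrite expRD mulrA ler_wpM2r ?expR_ge0.
Qed.

Let dcos y x : is_derive x (1:R) (fun u => cos (c + u * y)) (- (y * sin (c + x * y))).
Proof.
have dm : is_derive x (1:R) (fun u : R => c + u * y) y.
  rewrite (_ : (fun u : R => c + u * y) = cst c + y \*: id); last first.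
    by apply/funext => z; rewrite fctE/= mulrC.
  by apply: is_derive_eq; rewrite /GRing.scale/= mulr1 add0r.
have := @is_derive1_comp _ (@cos R) (fun u : R => c + u * y) x _ _ (is_derive_cos _) dm.
by move/is_derive_eq; apply; ring.
Qed.

Let dsin u x : is_derive x (1:R) (fun x => sin (c + u * x)) (u * cos (c + u * x)).
Proof.
have dm : is_derive x (1:R) (fun z : R => c + u * z) u.
  rewrite (_ : (fun z : R => c + u * z) = cst c + u \*: id)//.
  by apply: is_derive_eq; rewrite /GRing.scale/= mulr1 add0r.
have := @is_derive1_comp _ (@sin R) (fun z : R => c + u * z) x _ _ (is_derive_sin _) dm.
by move/is_derive_eq; apply; ring.
Qed.

Let dexp (a x : R) : is_derive x (1:R) (fun x => expR (a * x ^+ 2 / 2)) (a * x * expR (a * x ^+ 2 / 2)).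
Proof.
have dm : is_derive x (1:R) (fun z : R => a * z ^+ 2 / 2) (a * x).
  rewrite (_ : (fun z : R => a * z ^+ 2 / 2) = (a / 2) \*: (id ^+ 2)); last first.
    by apply/funext => z /=; rewrite fctE/= /GRing.scale/=; ring.
  by apply: is_derive_eq; rewrite /GRing.scale/=; field.
have := @is_derive1_comp _ (@expR R) (fun z : R => a * z ^+ 2 / 2) x _ _ (is_derive_expR _) dm.
by move/is_derive_eq; apply; ring.
Qed.

Let dpdf x : is_derive x (1:R) pdf (- (x * pdf x)).
Proof.
rewrite pdfE.
rewrite (_ : (fun x => _) = normal_peak 1 \*: (fun x => expR (-1 * x ^+ 2 / 2))); last first.
  by apply/funext => z /=; rewrite mulN1r.
have := dexp (-1) x => h; apply: is_derive_eq.
by rewrite /GRing.scale/= !mulN1r; ring.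
Qed.

Let h u := \int[mu]_x (cos (c + u * x) * pdf x).

Let measurable_mull u : measurable_fun setT (fun x => c + u * x).
Proof. by apply: measurable_funD => //; exact: measurable_funM. Qed.

Let measurable_sinM u : measurable_fun setT (fun x => sin (c + u * x)).
Proof.
apply: measurableT_comp (measurable_mull u) => //.
by apply: continuous_measurable_fun; exact: continuous_sin.
Qed.

Let measurable_xsin u : measurable_fun setT (fun x => x * sin (c + u * x)).
Proof. exact: measurable_funM. Qed.

Let bcos u : bounded_measurable (fun x => cos (c + u * x)).
Proof. exact: bounded_measurable_cos. Qed.

Let bcst (r : R) : bounded_measurable (fun _ : R => r).
Proof. exact: bounded_measurable_cst. Qed.

Let dh u : is_derive u (1:R) h (- \int[mu]_x (x * sin (c + u * x) * pdf x)).
Proof.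
pose f u x := cos (c + u * x) * pdf x.
have df v y : is_derive v (1:R) (f ^~ y) (- (y * sin (c + v * y)) * pdf y).
  rewrite (_ : f^~ y = pdf y \*: (fun v => cos (c + v * y))); last first.
    by apply/funext => z /=; rewrite /f mulrC.
  have := dcos y v => ?; apply: is_derive_eq.
  by rewrite /GRing.scale/= mulrC.
have pf v y : partial1of2 f v y = - (y * sin (c + v * y)) * pdf y.
  by rewrite partial1of2E; have [_ ->] := df v y.
have u1 : [set` `](u - 1), (u + 1)[ ] u by rewrite /= in_itv/=; apply/andP; split; lra.
have intf x : [set` `](u - 1), (u + 1)[ ] x -> mu.-integrable setT (EFin \o f x).
  by move=> _; exact: integrable_pdfM.
have derf x y : [set` `](u - 1), (u + 1)[ ] x -> setT y -> derivable (f ^~ y) x 1.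
  by move=> _ _; have [] := df x y.
have G0 y : 0 <= `|y| * pdf y by rewrite mulr_ge0.
have Gub x y : [set` `](u - 1), (u + 1)[ ] x -> setT y -> `|partial1of2 f x y| <= `|y| * pdf y.
  move=> _ _; rewrite pf normrM normrN normrM (ger0_norm (pdf_ge0 y)).
  by rewrite ler_wpM2r// ler_piMr// sin_max.
apply: DeriveDef.
  exact: (derivable_under_integral measurableT u1 intf derf G0 integrable_norm_pdf Gub).
rewrite -derive1E (differentiation_under_integral measurableT u1 intf derf G0 integrable_norm_pdf Gub).
rewrite -mulN1r -RintegralZl//.
  by apply: eq_Rintegral => y _; rewrite pf; ring.
apply: le_integrable integrable_norm_pdf => //.
  by apply/measurable_EFinP/measurable_funM => //; exact: measurable_xsin.
move=> y _; rewrite /= lee_fin normrM normrM (normrM `|y|) normr_id.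
by rewrite ler_wpM2r// ler_piMr// sin_max.
Qed.

(** Integration by parts (Stein's identity): the integrand is the derivative of
    [- (sin (c + u * x) * pdf x)], which vanishes at both infinities. Combined with [dh] it yields
    h' = - u h. *)
Let ftc u : \int[mu]_x (x * sin (c + u * x) * pdf x - u * cos (c + u * x) * pdf x) = 0.
Proof.
pose f x := x * sin (c + u * x) * pdf x - u * cos (c + u * x) * pdf x.
pose F x := - (sin (c + u * x) * pdf x).
have dF x : is_derive x (1:R) F (f x).
  have := dsin u x; have := dpdf x => ? ?.
  rewrite (_ : F = - ((fun x => sin (c + u * x)) * pdf))//.
  by apply: is_derive_eq; rewrite /f /GRing.scale/=; ring.
have cpdf : continuous pdf by exact: continuous_normal_pdf.
have cF : continuous F.
  by move=> x; apply/differentiable_continuous/derivable1_diffP; have [] := dF x.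
have cmul : continuous (fun x : R => c + u * x).
  move=> x; apply: cvgD; first exact: cvg_cst.
  by apply: cvgM; [exact: cvg_cst|exact: cvg_id].
have cf : continuous f.
  move=> x; apply: cvgB; (apply: cvgM; last exact: cpdf); apply: cvgM.
  - exact: cvg_id.
  - by apply: continuous_comp; [exact: cmul|exact: continuous_sin].
  - exact: cvg_cst.
  - by apply: continuous_comp; [exact: cmul|exact: continuous_cos].
have mf : measurable_fun setT f by exact: continuous_measurable_fun.
pose I n := `[(- n.+1%:R), n.+1%:R]%classic : set R.
have mI n : measurable (I n) by exact: measurable_itv.
have FI n : (\int[mu]_x ((f x * \1_(I n) x)%:E) = (F n.+1%:R - F (- n.+1%:R))%:E)%E.
  rewrite EFinB -(@continuous_FTC2 _ f F).
  - rewrite [RHS]integral_mkcond; apply: eq_integral => x _; rewrite patchE indicE.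
    by rewrite /I; case: ifP => _; rewrite ?mulr1 ?mulr0.
  - by rewrite (@lt_trans _ _ 0)// ?oppr_lt0 ltr0n.
  - exact: continuous_subspaceT.
  - split; first by move=> x _; have [] := dF x.
    + by apply: cvg_at_right_filter; exact: cF.
    + by apply: cvg_at_left_filter; exact: cF.
  - by move=> x _; rewrite derive1E; have [_ ->] := dF x.
have mfI n : measurable_fun setT (fun x => f x * \1_(I n) x).
  by apply: measurable_funM => //; exact: measurable_indic.
have lim1 : ((\int[mu]_x ((f x * \1_(I n) x)%:E)) @[n --> \oo] -->
    \int[mu]_x ((f x)%:E))%E.
  apply: (@dominated_cvg _ _ _ mu setT measurableT _ _ (fun x => (`|x| * pdf x + `|u| * pdf x)%:E)) => //.
  - by move=> n; apply/measurable_EFinP; exact: mfI.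
  - move=> x _; apply: cvg_near_cst; near=> n.
    rewrite indicE mem_set ?mulr1// /I/= in_itv/= -ler_norml.
    apply: (@le_trans _ _ n%:R); last by rewrite ler_nat.
    by near: n; exact: nbhs_infty_ger.
  - have iD := integrableD measurableT integrable_norm_pdf
      (integrable_pdfM (bcst `|u|)).
    by apply: eq_integrable iD => // x _; rewrite /= EFinD.
  - move=> n x _; rewrite abse_EFin lee_fin normrM.
    apply: (@le_trans _ _ `|f x|); first by rewrite ler_piMr// indicE ger0_norm// lern1 leq_b1.
    rewrite (le_trans (ler_normB _ _))// !normrM !(ger0_norm (pdf_ge0 x)).
    by rewrite lerD// ler_wpM2r// ler_piMr// ?sin_max ?cos_max.
have lim2 : ((F n.+1%:R - F (- n.+1%:R))%:E @[n --> \oo] --> (0%:E : \bar R)).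
  apply/fine_cvgP; split; first exact: nearW.
  (* From 1 + x^2/2 <= exp(x^2/2) one gets exp(-x^2/2) <= 2/x for x >= 1, enough for the boundary
     terms to vanish. *)
  have pd n : pdf n.+1%:R <= normal_peak 1 * (2 / n.+1%:R) :> R.
    rewrite pdfE ler_wpM2l ?normal_peak_ge0// mulNr expRN.
    rewrite -[2 / _]invrK invf_div lef_pV2 ?posrE ?expR_gt0 ?divr_gt0 ?ltr0n//.
    apply: le_trans (ltW (expR_gt1Dx _)); last first.
      by rewrite mulf_neq0 ?invr_neq0// expf_neq0// pnatr_eq0.
    have n1 : 1 <= n.+1%:R :> R by rewrite ler1n.
    by rewrite -[n.+1%:R in leLHS]mulr1; nra.
  apply/norm_cvg0P.
  apply: (@squeeze_cvgr _ _ _ _ (cst 0) (fun n => 2 * (normal_peak 1 * 2) * harmonic n)).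
  - apply: nearW => n /=; rewrite normr_ge0/= /F.
    have pe : pdf (- n.+1%:R) = pdf n.+1%:R by rewrite pdfE sqrrN.
    rewrite pe opprK; apply: le_trans (ler_normD _ _) _.
    rewrite normrN !normrM (ger0_norm (pdf_ge0 _)).
    have := pd n; rewrite /harmonic/= => pdn.
    have s1 := sin_max (c + u * n.+1%:R); have s2 := sin_max (c + u * - n.+1%:R).
    apply: (@le_trans _ _ (pdf n.+1%:R + pdf n.+1%:R)).
      by rewrite lerD// ler_piMl.
    apply: le_trans (lerD pdn pdn) _; rewrite le_eqVlt; apply/orP; left.
    by apply/eqP; ring.
  - exact: cvg_cst.
  - rewrite -[X in _ --> X](mulr0 (2 * (normal_peak 1 * 2))).
    by apply: cvgM; [exact: cvg_cst|exact: cvg_harmonic].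
rewrite /Rintegral -/(f _).
have -> : (\int[mu]_x (f x)%:E = 0)%E; last by [].
move: lim1; rewrite (_ : (fun n => _) = (fun n => (F n.+1%:R - F (- n.+1%:R))%:E)).
  by move=> lim1; exact: (cvg_unique _ lim1 lim2).
by apply/funext => n; rewrite FI.
Unshelve. all: by end_near. Qed.

(** The phase [c] lets the cosine carry the sine transform as well, which avoids complex numbers. *)
Lemma Rintegral_normal_cos u :
  \int[N01]_x cos (c + u * x) = cos c * expR (- u ^+ 2 / 2).
Proof.
rewrite Rintegral_normal_prob01//.
have -> : \int[mu]_x (pdf x * cos (c + u * x)) = h u.
  by apply: eq_Rintegral => x _; rewrite mulrC.
have ixs v : mu.-integrable setT (EFin \o (fun x => x * sin (c + v * x) * pdf x)).
  apply: le_integrable integrable_norm_pdf => //.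
    by apply/measurable_EFinP/measurable_funM => //; exact: measurable_xsin.
  move=> y _; rewrite /= lee_fin normrM normrM (normrM `|y|) normr_id.
  by rewrite ler_wpM2r// ler_piMr// sin_max.
have h' v : - (\int[mu]_x (x * sin (c + v * x) * pdf x)) = - (v * h v).
  congr (- _); apply/eqP; rewrite -subr_eq0 -RintegralZl//; last exact: integrable_pdfM.
  rewrite -RintegralB//; last exact: (integrableZl measurableT v (integrable_pdfM (bcos v))).
  apply/eqP; rewrite -[RHS](ftc v); apply: eq_Rintegral => x _.
  by rewrite mulrA.
(* By h' = - u h this product has zero derivative in u. *)
have : h u * expR (1 * u ^+ 2 / 2) = h 0 * expR (1 * 0 ^+ 2 / 2).
  apply: (@is_derive_0_is_cst _ (h * (fun u => expR (1 * u ^+ 2 / 2)))) => v.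
  have := dh v; have := dexp 1 v => ? ?; apply: is_derive_eq.
  by rewrite h' /GRing.scale/=; ring.
rewrite expr0n/= mulr0 mul0r expR0 mulr1 mul1r.
have -> : h 0 = cos c.
  rewrite /h; under eq_Rintegral do rewrite mul0r addr0.
  rewrite RintegralZl//; last exact: integrable_normal_pdf.
  by rewrite /Rintegral integral_normal_pdf mulr1.
move=> hE; rewrite mulNr expRN.
apply: (mulIf (lt0r_neq0 (expR_gt0 (u ^+ 2 / 2)))).
by rewrite hE mulfVK// gt_eqF// expR_gt0.
Qed.

End normal_charfun.

(** * Linear combinations of independent standard normal variables *)

Section gaussian_family.
Context dT (T : measurableType dT) (R : realType) (P : probability T R) (n : nat).
Variable Z : 'I_n -> T -> R.
Hypothesis mZ : forall i, measurable_fun setT (Z i).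
Hypothesis lawZ : forall i (B : set R), measurable B ->
  P (Z i @^-1` B) = normal_prob 0 1 B.
Hypothesis indepZ : mutually_independent P Z.

Let box (B : 'I_n -> set R) := \bigcap_(j in [set: 'I_n]) (Z j @^-1` B j).

Let measurable_preimage i (B : set R) : measurable B -> measurable (Z i @^-1` B).
Proof. by move=> mB; rewrite -(setTI (_ @^-1` _)); exact: mZ. Qed.

Let measurable_box B : (forall j, measurable (B j)) -> measurable (box B).
Proof. by move=> mB; apply: fin_bigcap_measurable => // j _; exact: measurable_preimage. Qed.

Let upd (B : 'I_n -> set R) i B0 j := if j == i then B0 else B j.

Let box_upd B i B0 : B i = setT -> box (upd B i B0) = Z i @^-1` B0 `&` box B.
Proof.
move=> Bi; apply/seteqP; split => [w bw|w [wi bw] j _].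
  split; first by have := bw i I; rewrite /upd/= eqxx.
  by move=> j _; have := bw j I; rewrite /upd/=; case: eqP => // -> _; rewrite Bi.
by rewrite /upd/=; case: eqP => [->//|_]; exact: bw.
Qed.

Let P_box_upd B i B0 : (forall j, measurable (B j)) -> measurable B0 ->
  B i = setT ->
  fine (P (box (upd B i B0))) = fine (normal_prob 0 1 B0) * fine (P (box B)).
Proof.
move=> mB mB0 Bi.
have mu j : measurable (upd B i B0 j) by rewrite /upd; case: ifP.
rewrite /box !indepZ// (bigD1 i)//= [in RHS](bigD1 i)//= Bi preimage_setT probability_setT mul1e.
rewrite {1}/upd eqxx lawZ// (eq_bigr (fun j => P (Z j @^-1` B j))); last first.
  by move=> j /negbTE ji; rewrite /upd ji.
rewrite fineM//.
  by apply: fin_num_measure.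
by rewrite prode_fin_num// => j _; apply: fin_num_measure; exact: measurable_preimage.
Qed.

Variable a : 'I_n -> R.

Let lin (s : seq 'I_n) w := \sum_(j <- s) a j * Z j w.

Let measurable_lin s : measurable_fun setT (lin s).
Proof.
apply: measurable_sum => j; exact: measurable_funM.
Qed.

(** Independence is given only as a product rule on boxes, so coordinates are integrated one at a
    time. The indicator of a box that is free along [s] makes the induction close: shrinking this
    box along [i] in the induction hypothesis tells how the remaining cosine is weighted against the
    law of [Z i]. *)
Let Rintegral_cos_box s : uniq s -> forall b B, (forall j, measurable (B j)) ->
  (forall j, j \in s -> B j = setT) ->
  \int[P]_w (cos (b + lin s w) * \1_(box B) w) =
  cos b * expR (- (\sum_(j <- s) a j ^+ 2) / 2) * fine (P (box B)).
Proof.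
elim: s => [_ b B mB _|i s IH /= /andP[iNs us] b B mB Bs].
  rewrite big_nil oppr0 mul0r expR0 mulr1.
  under eq_Rintegral do rewrite /lin big_nil addr0.
  rewrite RintegralZl//; last first.
    by apply: bounded_measurable_integrable; apply: bounded_measurable_indic; exact: measurable_box.
  by rewrite /Rintegral integral_indic ?setIT//; exact: measurable_box.
have Bi : B i = setT by apply: Bs; rewrite mem_head.
have bV : bounded_measurable (\1_(box B) : T -> R).
  by apply: bounded_measurable_indic; exact: measurable_box.
have bC b' : bounded_measurable (fun w => cos (b' + lin s w)).
  by apply: bounded_measurable_cos; apply: measurable_funD.
have bcos1 : forall t x, bounded_measurable (fun y : R => cos (t + x * y)).
  by move=> t x; apply: bounded_measurable_cos; exact: measurable_funD.
set e := expR (- (\sum_(j <- s) a j ^+ 2) / 2) in IH *.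
set c := fine (P (box B)).
have indE B0 w : \1_(box (upd B i B0)) w = \1_(box B) w * \1_B0 (Z i w) :> R.
  by rewrite box_upd// setIC indicI.
have hW b' B0 : measurable B0 -> \int[P]_w (cos (b' + lin s w) * \1_(box B) w * \1_B0 (Z i w))
    = cos b' * e * c * fine (normal_prob 0 1 B0).
  move=> mB0; under eq_Rintegral do rewrite -mulrA -indE.
  rewrite IH//.
  - by rewrite P_box_upd// -/c; ring.
  - by move=> j; rewrite /upd; case: ifP.
  - move=> j js; rewrite /upd; case: eqP => [ji|_]; first by rewrite -ji js in iNs.
    by rewrite Bs// inE js orbT.
have hV B0 : measurable B0 -> \int[P]_w (\1_(box B) w * \1_B0 (Z i w)) = c * fine (normal_prob 0 1 B0).
  move=> mB0; under eq_Rintegral do rewrite -indE.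
  have mu : measurable (box (upd B i B0)).
    by apply: measurable_box => j; rewrite /upd; case: ifP.
  by rewrite /Rintegral integral_indic// setIT P_box_upd// mulrC.
have bZ (f : R -> R) : bounded_measurable f -> bounded_measurable (fun w => f (Z i w)).
  move=> [mf [M fM]]; split; last by exists M => w.
  exact: measurableT_comp.
have ev b' t : \int[P]_w (cos (b' + lin s w) * \1_(box B) w * cos (t + a i * Z i w)) =
    cos b' * e * c * (cos t * expR (- a i ^+ 2 / 2)).
  have bW := bounded_measurableM (bC b') bV.
  (* The transfer lemma needs a nonnegative weight: cos is replaced by 1 + cos, and the contribution
     of 1, known from [tV], is subtracted afterwards. *)
  have W0 w : 0 <= \1_(box B) w + cos (b' + lin s w) * \1_(box B) w :> R.
    rewrite -[X in X + _]mul1r -mulrDl mulr_ge0//.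
  have V0 w : 0 <= \1_(box B) w :> R by rewrite indicE.
  rewrite -Rintegral_normal_cos.
  have tV := @Rintegral_weighted_transfer _ _ _ _ _ P (normal_prob 0 1) _ (Z i) c
    (bounded_measurable_integrable P bV) V0 (mZ i) hV _ (bcos1 t (a i)).
  have hVW B0 : measurable B0 ->
     \int[P]_w ((\1_(box B) w + cos (b' + lin s w) * \1_(box B) w) * \1_B0 (Z i w)) =
     (c + cos b' * e * c) * fine (normal_prob 0 1 B0).
    move=> mB0; rewrite mulrDl -hV// -hW// -RintegralD//.
    - by apply: eq_Rintegral => w _; rewrite mulrDl.
    - apply: bounded_measurable_integrable; apply: bounded_measurableM => //.
      by apply: bZ; exact: bounded_measurable_indic.
    - apply: bounded_measurable_integrable; apply: bounded_measurableM => //.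
      by apply: bZ; exact: bounded_measurable_indic.
  have := @Rintegral_weighted_transfer _ _ _ _ _ P (normal_prob 0 1) _ (Z i) (c + cos b' * e * c)
    (bounded_measurable_integrable P (bounded_measurableD bV bW)) W0 (mZ i) hVW _ (bcos1 t (a i)).
  have -> : \int[P]_w ((\1_(box B) w + cos (b' + lin s w) * \1_(box B) w) * cos (t + a i * Z i w)) =
     \int[P]_w (\1_(box B) w * cos (t + a i * Z i w)) +
     \int[P]_w (cos (b' + lin s w) * \1_(box B) w * cos (t + a i * Z i w)).
    rewrite -RintegralD//.
    - by apply: eq_Rintegral => w _; rewrite mulrDl.
    - apply: bounded_measurable_integrable; apply: bounded_measurableM => //.
      exact: (bZ _ (bcos1 t (a i))).
    - apply: bounded_measurable_integrable; apply: bounded_measurableM => //.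
      exact: (bZ _ (bcos1 t (a i))).
  by rewrite tV mulrDl => /addrI.
(* This is cos(p + q) = cos p cos q - sin p sin q, with each sine written as a cosine shifted by
   pi/2. The second integral then carries the factor cos(-pi/2) = 0. *)
have -> : \int[P]_w (cos (b + lin (i :: s) w) * \1_(box B) w) =
   \int[P]_w (cos (b + lin s w) * \1_(box B) w * cos (0 + a i * Z i w)) -
   \int[P]_w (cos ((b - pi / 2) + lin s w) * \1_(box B) w * cos (- (pi / 2) + a i * Z i w)).
  rewrite -RintegralB//; last 2 first.
  - apply: bounded_measurable_integrable; apply: bounded_measurableM; first exact: bounded_measurableM.
    exact: (bZ _ (bcos1 0 (a i))).
  - apply: bounded_measurable_integrable; apply: bounded_measurableM; first exact: bounded_measurableM.
    exact: (bZ _ (bcos1 (- (pi / 2)) (a i))).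
  apply: eq_Rintegral => w _.
  rewrite (addrAC b) cosBpihalf add0r (addrC (- (pi / 2))) cosBpihalf.
  have -> : b + lin (i :: s) w = b + lin s w + a i * Z i w by rewrite /lin big_cons addrCA addrC.
  by rewrite cosD; ring.
rewrite !ev cos0 big_cons (_ : cos (- (pi / 2)) = 0); last by rewrite cosN cos_pihalf.
rewrite (_ : expR (- (_ + _) / 2) = expR (- a i ^+ 2 / 2) * e); first by ring.
by rewrite /e -expRD -mulrDl -opprD.
Qed.

Lemma Rintegral_cos_gaussian b :
  \int[P]_w cos (b + \sum_j a j * Z j w) = cos b * expR (- (\sum_j a j ^+ 2) / 2).
Proof.
have := Rintegral_cos_box (index_enum_uniq 'I_n) b (fun _ => measurableT) (fun _ _ => erefl).
rewrite (_ : box _ = setT); last by apply/seteqP; split.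
by rewrite probability_setT mulr1; under eq_Rintegral do rewrite indicT mulr1.
Qed.

End gaussian_family.

(** * Bounds on hyperbolic functions *)

Section sinh_bounds.
Variable R : realType.
Implicit Types x v : R.

Lemma sinh_le x : 0 <= x -> expR x - expR (- x) <= 2 * x * expR x.
Proof.
move=> x0; have := expR_ge1Dx (- (2 * x)).
have -> : expR (- x) = expR x * expR (- (2 * x)) by rewrite -expRD; congr expR; ring.
by have := expR_gt0 x; nra.
Qed.

(** The left side is the square of exp(x/2) - exp(-x/2), to which [sinh_le] applies. *)
Lemma cosh_sub1_le x : expR x + expR (- x) - 2 <= x ^+ 2 * expR `|x|.
Proof.
wlog x0 : x / 0 <= x.
  move=> h; have [/h//|xlt] := leP 0 x.
  by have := h (- x); rewrite opprK sqrrN normrN oppr_ge0 => /(_ (ltW xlt)); lra.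
rewrite ger0_norm//.
have x20 : 0 <= x / 2 by rewrite divr_ge0.
have := sinh_le x20; have := expR_gt0 (x / 2); have := expR_gt0 (- (x / 2)).
have -> : expR x = expR (x / 2) ^+ 2 by rewrite expr2 -expRD; congr expR; field.
have -> : expR (- x) = expR (- (x / 2)) ^+ 2 by rewrite expr2 -expRD; congr expR; field.
have : expR (x / 2) * expR (- (x / 2)) = 1 by rewrite -expRD subrr expR0.
have : expR (- (x / 2)) <= expR (x / 2) by rewrite ler_expR; lra.
move: (expR _) (expR _) => p q qp pq q0 p0; rewrite (_ : 2 * (x / 2) = x); last by field.
move=> h; have : (p - q) ^+ 2 <= (x * p) ^+ 2.
  by rewrite ler_sqr ?nnegrE ?subr_ge0// mulr_ge0// ltW.
by rewrite exprMn sqrrB; move: pq; nra.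
Qed.

(** To be used with x = v rho and |rho| <= 1: the factor exp(-v) cancels the growth of cosh, so that
    covariances stay polynomial in v. *)
Lemma damped_cosh_le x v : `|x| <= v ->
  expR (- v) * ((expR x + expR (- x)) / 2 - 1) <= x ^+ 2 / 2.
Proof.
move=> xv; have := cosh_sub1_le x.
have : expR (- v) * expR `|x| <= 1 by rewrite -expRD -expR0 ler_expR; lra.
have := expR_gt0 (- v); have := expR_gt0 `|x|; have := sqr_ge0 x.
set c := expR x + _; set p := expR (- v); set q := expR _ => x20 q0 p0 pq c2.
have : p * (c - 2) <= p * (x ^+ 2 * q) by rewrite ler_pM2l.
have : x ^+ 2 * (p * q) <= x ^+ 2 by rewrite ler_piMr.
by lra.
Qed.

Lemma damped_sinh_le x v : `|x| <= v ->
  `| expR (- v) * ((expR x - expR (- x)) / 2) | <= `|x|.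
Proof.
move=> xv.
have nm : `|(expR x - expR (- x)) / 2| <= `|x| * expR `|x|.
  rewrite normrM (@ger0_norm _ 2^-1) ?invr_ge0// ler_pdivrMr//.
  have [x0|x0] := leP 0 x.
    by rewrite (ger0_norm x0) ger0_norm ?subr_ge0 ?ler_expR; [have := sinh_le x0; lra|lra].
  rewrite (ltr0_norm x0) distrC ger0_norm ?subr_ge0 ?ler_expR; last lra.
  have x0' : 0 <= - x by lra.
  by have := sinh_le x0'; rewrite opprK; lra.
rewrite normrM (gtr0_norm (expR_gt0 _)).
have : expR (- v) * expR `|x| <= 1 by rewrite -expRD -expR0 ler_expR; lra.
have := expR_gt0 (- v); have := normr_ge0 x.
by move: (expR _) (expR _) nm => p q; move: `|_ / 2| `|x| => r y; nra.
Qed.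

End sinh_bounds.

(** * Covariances of cosines of correlated Gaussian variables *)

Section gaussian_pairs.
Context dT (T : measurableType dT) (R : realType) (P : probability T R) (d : nat).

(** This records all that is used of the noise. Thanks to the phase [b] it gives the full
    characteristic function of each pair: centred Gaussian with unit variances and correlation
    [rho i k]. *)
Definition gaussian_pairs (xi : 'I_d -> T -> R) (rho : 'I_d -> 'I_d -> R) :=
  [/\ forall i, measurable_fun setT (xi i),
      forall i k, `|rho i k| <= 1 &
      forall i k b x y, \int[P]_w cos (b + (x * xi i w + y * xi k w)) =
        cos b * expR (- (x ^+ 2 + y ^+ 2 + 2 * (x * y * rho i k)) / 2)].

Lemma gaussian_pairs_lin n (Z : 'I_n -> T -> R) (a : 'I_d -> 'I_n -> R) :
  (forall j, measurable_fun setT (Z j)) ->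
  (forall j (B : set R), measurable B -> P (Z j @^-1` B) = normal_prob 0 1 B) ->
  mutually_independent P Z ->
  (forall i, \sum_j a i j ^+ 2 = 1) ->
  gaussian_pairs (fun i w => \sum_j a i j * Z j w) (fun i k => \sum_j a i j * a k j).
Proof.
move=> mZ lZ iZ a1.
have quad i k x y : \sum_j (x * a i j + y * a k j) ^+ 2 =
    x ^+ 2 + y ^+ 2 + 2 * (x * y * \sum_j a i j * a k j).
  rewrite (eq_bigr (fun j => x ^+ 2 * a i j ^+ 2 +
    (y ^+ 2 * a k j ^+ 2 + 2 * (x * y) * (a i j * a k j)))).
    by rewrite !big_split/= -!mulr_sumr !a1; ring.
  by move=> j _; ring.
split.
- by move=> i; apply: measurable_sum => j; exact: measurable_funM.
(* The sums of squares at (x, y) = (1, 1) and (1, -1) are 2 + 2 rho and 2 - 2 rho. *)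
- move=> i k; rewrite ler_norml; apply/andP; split.
    have : 0 <= \sum_j (1 * a i j + 1 * a k j) ^+ 2 by apply: sumr_ge0 => j _; exact: sqr_ge0.
    by rewrite quad; lra.
  have : 0 <= \sum_j (1 * a i j + - 1 * a k j) ^+ 2 by apply: sumr_ge0 => j _; exact: sqr_ge0.
  by rewrite quad; lra.
- move=> i k b x y; rewrite -quad -(Rintegral_cos_gaussian mZ lZ iZ).
  apply: eq_Rintegral => w _; congr (cos (_ + _)).
  rewrite !mulr_sumr -big_split/=; apply: eq_bigr => j _; ring.
Qed.

Variables (xi : 'I_d -> T -> R) (rho : 'I_d -> 'I_d -> R).
Hypothesis G : gaussian_pairs xi rho.

Let mxi i : measurable_fun setT (xi i). Proof. by case: G. Qed.
Let rho1 i k : `|rho i k| <= 1. Proof. by case: G. Qed.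
Let Gcos i k b x y : \int[P]_w cos (b + (x * xi i w + y * xi k w)) =
  cos b * expR (- (x ^+ 2 + y ^+ 2 + 2 * (x * y * rho i k)) / 2).
Proof. by case: G. Qed.

Let bcosxi i b x : bounded_measurable (fun w => cos (b + x * xi i w)).
Proof.
by apply: bounded_measurable_cos; apply: measurable_funD => //; exact: measurable_funM.
Qed.

Let Gcos1 i b x : \int[P]_w cos (b + x * xi i w) = cos b * expR (- x ^+ 2 / 2).
Proof.
have := Gcos i i b x 0; rewrite expr0n/= !mulr0 mul0r mulr0 !addr0 => <-.
by apply: eq_Rintegral => w _; rewrite mul0r addr0.
Qed.

Variables (al : 'I_d -> R) (c : R).
Let v := c ^+ 2.
Let X i w := cos (al i + c * xi i w) - cos (al i) * expR (- v / 2).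

Let bX i : bounded_measurable (X i).
Proof. by apply: bounded_measurableB => //; exact: bounded_measurable_cst. Qed.

(** With r = v rho, the covariance equals cos(al i) cos(al k) exp(-v) (cosh r - 1) + sin(al i)
    sin(al k) exp(-v) sinh r. The part of first order in rho thus carries two sines, which vanish at
    coordinates with zero phase. *)
Let EXX i k : \int[P]_w (X i w * X k w) <=
  v ^+ 2 * rho i k ^+ 2 / 2 + v * (`|sin (al i)| * `|sin (al k)| * `|rho i k|).
Proof.
pose E := expR (- v / 2).
have EE : E * E = expR (- v) by rewrite /E -expRD; congr expR; field.
have eqX w : X i w * X k w =
  2^-1 * cos (al i + al k + (c * xi i w + c * xi k w)) +
  (2^-1 * cos (al i - al k + (c * xi i w + (- c) * xi k w)) +
  (- (cos (al k) * E) * cos (al i + c * xi i w) +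
  (- (cos (al i) * E) * cos (al k + c * xi k w) + cos (al i) * cos (al k) * expR (- v)))).
  rewrite -EE.
  have -> : al i + al k + (c * xi i w + c * xi k w) = (al i + c * xi i w) + (al k + c * xi k w) by ring.
  have -> : al i - al k + (c * xi i w + - c * xi k w) = (al i + c * xi i w) - (al k + c * xi k w) by ring.
  by rewrite cosD cosB /X -/E; field.
have bc1 r (f : T -> R) : bounded_measurable f -> bounded_measurable (fun w => r * f w).
  by apply: bounded_measurableM; exact: bounded_measurable_cst.
have b1 b x y : bounded_measurable (fun w => cos (b + (x * xi i w + y * xi k w))).
  apply: bounded_measurable_cos; apply: measurable_funD => //.
  by apply: measurable_funD => //; exact: measurable_funM.
have bint f : bounded_measurable f -> P.-integrable setT (EFin \o f).
  exact: bounded_measurable_integrable.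
have -> : \int[P]_w (X i w * X k w) =
   2^-1 * (cos (al i + al k) * expR (- (c ^+ 2 + c ^+ 2 + 2 * (c * c * rho i k)) / 2)) +
   (2^-1 * (cos (al i - al k) * expR (- (c ^+ 2 + (- c) ^+ 2 + 2 * (c * - c * rho i k)) / 2)) +
   (- (cos (al k) * E) * (cos (al i) * E) +
   (- (cos (al i) * E) * (cos (al k) * E) + cos (al i) * cos (al k) * expR (- v)))).
  under eq_Rintegral do rewrite eqX.
  have bcc (r : R) : bounded_measurable (fun _ : T => r) by exact: bounded_measurable_cst.
  have bk := bounded_measurableD (bc1 (- (cos (al i) * E)) _ (bcosxi k (al k) c)) (bcc (cos (al i) * cos (al k) * expR (- v))).
  have bi := bounded_measurableD (bc1 (- (cos (al k) * E)) _ (bcosxi i (al i) c)) bk.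
  have b2 := bounded_measurableD (bc1 2^-1 _ (b1 (al i - al k) c (- c))) bi.
  have b3 := bc1 2^-1 _ (b1 (al i + al k) c c).
  rewrite (RintegralD measurableT (bint _ b3) (bint _ b2)).
  rewrite (RintegralD measurableT (bint _ (bc1 2^-1 _ (b1 (al i - al k) c (- c)))) (bint _ bi)).
  rewrite (RintegralD measurableT (bint _ (bc1 (- (cos (al k) * E)) _ (bcosxi i (al i) c))) (bint _ bk)).
  rewrite (RintegralD measurableT (bint _ (bc1 (- (cos (al i) * E)) _ (bcosxi k (al k) c))) (bint _ (bcc _))).
  rewrite !RintegralZl//; try exact: bint.
  rewrite !Gcos !Gcos1 Rintegral_cst// (_ : fine _ = 1) ?mulr1//.
  by rewrite -[RHS]/(fine 1%E); congr fine; exact: probability_setT.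
set r := v * rho i k.
have -> : - (c ^+ 2 + c ^+ 2 + 2 * (c * c * rho i k)) / 2 = - v + - r by rewrite /r /v; field.
have -> : - (c ^+ 2 + (- c) ^+ 2 + 2 * (c * - c * rho i k)) / 2 = - v + r by rewrite /r /v; field.
rewrite !expRD cosD cosB -EE.
have v0 : 0 <= v by exact: sqr_ge0.
have rv : `|r| <= v by rewrite normrM (ger0_norm v0) ler_piMr.
have r2 : v ^+ 2 * rho i k ^+ 2 / 2 = r ^+ 2 / 2 by rewrite /r; ring.
have r1 : v * (`|sin (al i)| * `|sin (al k)| * `|rho i k|) = `|sin (al i) * sin (al k)| * `|r|.
  have -> : `|r| = v * `|rho i k| by rewrite normrM (ger0_norm v0).
  by rewrite normrM; ring.
rewrite r2 r1.
have h1 := damped_cosh_le rv; have h2 := damped_sinh_le rv.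
pose A := expR (- v) * ((expR r + expR (- r)) / 2 - 1).
pose B := expR (- v) * ((expR r - expR (- r)) / 2).
rewrite [leLHS](_ : _ = cos (al i) * cos (al k) * A + sin (al i) * sin (al k) * B); last first.
  by rewrite /A /B -EE; field.
have A0 : 0 <= A.
  rewrite mulr_ge0 ?expR_ge0//.
  have : expR r * expR (- r) = 1 by rewrite -expRD subrr expR0.
  have := expR_gt0 r; have := expR_gt0 (- r).
  move: (expR _) (expR _) => p q p0 q0 qp.
  by have := sqr_ge0 (p - q); rewrite sqrrB; nra.
apply: lerD.
  apply: le_trans h1; rewrite -/A.
  apply: le_trans (ler_norm _) _; rewrite normrM (ger0_norm A0) ler_piMl//.
  by rewrite normrM mulr_ile1 ?cos_max.
apply: le_trans (ler_norm _) _; rewrite normrM ler_wpM2l//.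
Qed.

Lemma second_moment_cos_sum :
  \int[P]_w ((\sum_i X i w) ^+ 2) <=
  v ^+ 2 / 2 * (\sum_i \sum_k rho i k ^+ 2) +
  v * \sum_i \sum_k (`|sin (al i)| * `|sin (al k)| * `|rho i k|).
Proof.
have -> : \int[P]_w ((\sum_i X i w) ^+ 2) = \sum_i \sum_k \int[P]_w (X i w * X k w).
  under eq_Rintegral do rewrite expr2 mulr_suml.
  rewrite Rintegral_bounded_sum; last first.
    move=> i; apply: bounded_measurableM => //.
    exact: bounded_measurable_sum.
  apply: eq_bigr => i _; under eq_Rintegral do rewrite mulr_sumr.
  by rewrite Rintegral_bounded_sum// => k; exact: bounded_measurableM.
rewrite !mulr_sumr -big_split/=; apply: ler_sum => i _.
rewrite !mulr_sumr -big_split/=; apply: ler_sum => k _.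
by apply: le_trans (EXX i k) _; rewrite lerD2r mulrAC.
Qed.

End gaussian_pairs.

(** * The square as a limit of cosines *)

Section cos_quotient.
Variable R : realType.

Lemma is_derive_cvg_quotient (f : R -> R) (l : R) (t : nat -> R) :
  is_derive (0:R) (1:R) f l -> (forall n, t n != 0) -> t n @[n --> \oo] --> (0:R) ->
  (f (t n) - f 0) / t n @[n --> \oo] --> l.
Proof.
move=> [df <-] t0 tc; have /cvgr_dnbhsP/(_ t (conj t0 tc)) := df.
rewrite [X in _ --> _ -> X @ _ --> _](_ : _ =
  (fun n => (t n)^-1 *: ((f \o shift 0) (t n)%:A - f 0)))//.
by apply/funext => n; rewrite /= addr0 /GRing.scale/= mulr1 mulrC.
Qed.

(** With h = 1/(n+1) and cos(h x) = 1 - 2 sin^2(h x/2), the expression is 4 (sin(h x/2)/h)^2 + 2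
    (exp(-h^2/2) - 1)/h^2; these difference quotients at 0 give the limits x^2 and -1. *)
Lemma cvg_cos_quotient (x : R) :
  2 * n.+1%:R ^+ 2 * (expR (- n.+1%:R^-1 ^+ 2 / 2) - cos (n.+1%:R^-1 * x))
    @[n --> \oo] --> x ^+ 2 - 1.
Proof.
pose h n : R := n.+1%:R^-1.
have h0 n : h n != 0 by rewrite invr_neq0// pnatr_eq0.
have hc : h n @[n --> \oo] --> (0:R) by exact: cvg_harmonic.
have hE n : n.+1%:R = (h n)^-1 :> R by rewrite invrK.
have ds : is_derive (0:R) (1:R) (fun t => sin (t * (x / 2))) (x / 2).
  have dm : is_derive (0:R) (1:R) (fun u : R => u * (x / 2)) (x / 2).
    rewrite (_ : (fun u : R => _) = (x / 2) \*: id); last by apply/funext => z /=; rewrite mulrC.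
    by apply: is_derive_eq; rewrite /GRing.scale/= mulr1.
  have := @is_derive1_comp _ (@sin R) (fun u : R => u * (x / 2)) 0 _ _ (is_derive_sin _) dm.
  by move/is_derive_eq; apply; rewrite mul0r cos0 mul1r.
have de : is_derive (0:R) (1:R) (fun t => expR (t * (- 2^-1))) (- 2^-1 : R).
  have dm : is_derive (0:R) (1:R) (fun u : R => u * (- 2^-1)) (- 2^-1).
    rewrite (_ : (fun u : R => _) = (- 2^-1) \*: id); last by apply/funext => z /=; rewrite mulrC.
    by apply: is_derive_eq; rewrite /GRing.scale/= mulr1.
  have := @is_derive1_comp _ (@expR R) (fun u : R => u * (- 2^-1)) 0 _ _ (is_derive_expR _) dm.
  by move/is_derive_eq; apply; rewrite mul0r expR0 mul1r.
have cs := is_derive_cvg_quotient ds h0 hc.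
have h20 n : h n ^+ 2 != 0 by rewrite expf_neq0.
have h2c : h n ^+ 2 @[n --> \oo] --> (0:R).
  rewrite -[X in _ --> X](mulr0 (0:R)); under eq_fun do rewrite expr2.
  exact: cvgM.
have ce := is_derive_cvg_quotient de h20 h2c.
have lim : 4 * (((sin (h n * (x / 2)) - sin (0 * (x / 2))) / h n) * ((sin (h n * (x / 2)) - sin (0 * (x / 2))) / h n))
   + 2 * ((expR (h n ^+ 2 * (- 2^-1)) - expR (0 * (- 2^-1))) / h n ^+ 2)
   @[n --> \oo] --> 4 * ((x / 2) * (x / 2)) + 2 * (- 2^-1).
  apply: cvgD; (apply: cvgM; first exact: cvg_cst); last exact: ce.
  by apply: cvgM; exact: cs.
rewrite (_ : x ^+ 2 - 1 = 4 * ((x / 2) * (x / 2)) + 2 * (- 2^-1)); last by field.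
apply: cvg_trans lim; apply: near_eq_cvg; near=> n.
rewrite !mul0r sin0 expR0 subr0 -/(h n) (hE n).
have -> : h n * x = h n * (x / 2) + h n * (x / 2) by field.
rewrite cosD -!expr2 cos2sin2 mulrN -mulNr.
rewrite (_ : - h n ^+ 2 / 2 = - h n ^+ 2 * 2^-1)//.
by move: (expR _) (sin _) => e q; field; exact: h0.
Unshelve. all: by end_near. Qed.

End cos_quotient.

(** * Second moments of sums over the coordinates *)

Section gaussian_second_moments.
Context dT (T : measurableType dT) (R : realType) (P : probability T R) (d : nat).
Variables (xi : 'I_d -> T -> R) (rho : 'I_d -> 'I_d -> R).
Hypothesis G : gaussian_pairs P xi rho.

Let mxi i : measurable_fun setT (xi i). Proof. by case: G. Qed.

(** The term linear in |rho| lives on the at most s^2 pairs with two nonzero phases. The weights s/F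
    and F/s balance its two halves at s F/2 each, which is Cauchy-Schwarz over these pairs. *)
Lemma second_moment_cos_sparse (al : 'I_d -> R) (c F s : R) :
  0 < F -> 0 < s -> \sum_i \sum_k rho i k ^+ 2 = F ^+ 2 ->
  #|[pred i | al i != 0]|%:R <= s ->
  \int[P]_w ((\sum_i (cos (al i + c * xi i w) - cos (al i) * expR (- c ^+ 2 / 2))) ^+ 2)
    <= c ^+ 4 * F ^+ 2 / 2 + c ^+ 2 * (s * F).
Proof.
move=> F0 s0 rhoF als; apply: le_trans (second_moment_cos_sum G al c) _.
rewrite rhoF (_ : c ^+ 2 ^+ 2 / 2 * F ^+ 2 = c ^+ 4 * F ^+ 2 / 2); last by ring.
rewrite lerD2l ler_wpM2l ?sqr_ge0//.
have ind i : `|sin (al i)| <= (al i != 0)%:R.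
  by case: eqP => [->|_]; rewrite ?sin0 ?normr0 ?sin_max.
apply: (@le_trans _ _ (\sum_i \sum_k ((s / F / 2) * rho i k ^+ 2 +
    (F / s / 2) * ((al i != 0)%:R * (al k != 0)%:R)))).
  apply: ler_sum => i _; apply: ler_sum => k _.
  apply: (@le_trans _ _ ((al i != 0)%:R * (al k != 0)%:R * `|rho i k|)).
    by rewrite ler_wpM2r// ler_pM.
  rewrite -(real_normK (num_real (rho i k))); move: `|rho i k| (normr_ge0 (rho i k)) => r r0.
  (* AM-GM *)
  have amgm : r <= s / F / 2 * r ^+ 2 + F / s / 2.
    rewrite -subr_ge0 (_ : _ - _ = (s * r - F) ^+ 2 / (2 * (s * F))); last first.
      by field; rewrite !gt_eqF.
    by rewrite divr_ge0 ?sqr_ge0// ltW// !mulr_gt0.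
  have sF : 0 <= s / F / 2 * r ^+ 2 by rewrite mulr_ge0 ?sqr_ge0// !divr_ge0// ltW.
  by case: (al i != 0); case: (al k != 0); rewrite /= ?mul1r ?mul0r ?mulr0 ?mulr1 ?addr0.
under eq_bigr do rewrite big_split/= -!mulr_sumr.
rewrite big_split/= -!mulr_sumr rhoF.
have cardE : \sum_i (al i != 0)%:R = #|[pred i | al i != 0]|%:R :> R.
  rewrite -sum1_card natr_sum [RHS]big_mkcond/=; apply: eq_bigr => i _.
  by rewrite inE; case: (al i != 0).
rewrite -mulr_suml cardE.
set N := #|_|%:R in als *.
have N0 : 0 <= N by exact: ler0n.
have NN : N * N <= s * s by rewrite ler_pM.
have : F / s / 2 * (N * N) <= F / s / 2 * (s * s).
  by rewrite ler_wpM2l// !divr_ge0// ltW.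
have -> : F / s / 2 * (s * s) = s * F / 2 by field; rewrite gt_eqF.
have -> : s / F / 2 * F ^+ 2 = s * F / 2 by field; rewrite gt_eqF.
by lra.
Qed.

(** The cosine approximations [f n] have second moments at most 2 F^2 for every n, the powers of n
    cancelling, and Fatou's lemma passes to the limit. The integral is an extended real because its
    finiteness is part of the conclusion. *)
Lemma second_moment_sqr_sum :
  (\int[P]_w ((\sum_i (xi i w ^+ 2 - 1)) ^+ 2)%:E <=
   (2 * \sum_i \sum_k rho i k ^+ 2)%:E)%E.
Proof.
pose f n w := (\sum_i (2 * n.+1%:R ^+ 2 * (expR (- n.+1%:R^-1 ^+ 2 / 2) - cos (n.+1%:R^-1 * xi i w)))) ^+ 2.
have bf n : bounded_measurable (f n).
  have bs : bounded_measurable (fun w => \sum_i (2 * n.+1%:R ^+ 2 * (expR (- n.+1%:R^-1 ^+ 2 / 2) - cos (n.+1%:R^-1 * xi i w))) : R).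
    apply: bounded_measurable_sum => i; apply: bounded_measurableM; first exact: bounded_measurable_cst.
    apply: bounded_measurableB; first exact: bounded_measurable_cst.
    by apply: bounded_measurable_cos; exact: measurable_funM.
  by rewrite /f; under eq_fun do rewrite expr2; exact: bounded_measurableM.
have fcvg w : (f n w)%:E @[n --> \oo] --> ((\sum_i (xi i w ^+ 2 - 1)) ^+ 2)%:E.
  apply/fine_cvgP; split; first exact: nearW.
  rewrite /comp/= /f expr2; under eq_fun do rewrite expr2.
  have sc : \sum_i (2 * n.+1%:R ^+ 2 * (expR (- n.+1%:R^-1 ^+ 2 / 2) - cos (n.+1%:R^-1 * xi i w)))
      @[n --> \oo] --> \sum_i (xi i w ^+ 2 - 1).
    by apply: cvg_big; [exact: add_continuous|move=> i _; exact: cvg_cos_quotient].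
  exact: cvgM.
have fle n : (\int[P]_w (f n w)%:E <= (2 * \sum_i \sum_k rho i k ^+ 2)%:E)%E.
  rewrite -[leLHS]fineK; last exact: integrable_fin_num (bounded_measurable_integrable P (bf n)).
  rewrite lee_fin.
  have h0 : n.+1%:R != 0 :> R by rewrite pnatr_eq0.
  have -> : fine (\int[P]_w (f n w)%:E)%E =
     4 * n.+1%:R ^+ 4 * \int[P]_w ((\sum_i (cos (0 + n.+1%:R^-1 * xi i w) - cos 0 * expR (- n.+1%:R^-1 ^+ 2 / 2))) ^+ 2).
    rewrite -RintegralZl//.
      apply: eq_Rintegral => w _; rewrite /f -mulr_sumr exprMn.
      rewrite -(opprK (\sum_i (expR _ - _))) sqrrN -sumrN.
      under [in RHS]eq_bigr do rewrite add0r cos0 mul1r.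
      under [in LHS]eq_bigr do rewrite opprB.
      by ring.
    apply: bounded_measurable_integrable.
    have bs : bounded_measurable (fun w => \sum_i (cos (0 + n.+1%:R^-1 * xi i w) - cos 0 * expR (- n.+1%:R^-1 ^+ 2 / 2))).
      apply: bounded_measurable_sum => i.
      apply: bounded_measurableB; last exact: bounded_measurable_cst.
      by apply: bounded_measurable_cos; apply: measurable_funD => //; exact: measurable_funM.
    by under eq_fun do rewrite expr2; exact: bounded_measurableM.
  apply: le_trans (ler_wpM2l _ (second_moment_cos_sum G (fun=> 0) n.+1%:R^-1)) _.
    by rewrite mulr_ge0// exprn_ge0.
  rewrite (_ : \sum_i \sum_k (`|sin 0| * `|sin 0| * `|rho i k|) = 0); last first.
    by rewrite big1// => i _; rewrite big1// => k _; rewrite sin0 normr0 !mul0r.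
  rewrite mulr0 addr0 le_eqVlt; apply/orP; left; apply/eqP.
  by move: (\sum_i _) => S; field; rewrite addrC natr1 h0.
have mf n : measurable_fun setT (EFin \o f n) by apply/measurable_EFinP; exact: (bf n).1.
have f0 n w : setT w -> (0 <= (EFin \o f n) w)%E by move=> _; rewrite lee_fin sqr_ge0.
have := fatou P measurableT mf f0.
rewrite (eq_integral (fun w => ((\sum_i (xi i w ^+ 2 - 1)) ^+ 2)%:E)); last first.
  by move=> w _; have [-> _] := cvg_limn_einf_sup (fcvg w).
move/le_trans; apply; rewrite limn_einf_lim; apply: lime_le; first exact: is_cvg_einfs.
by apply: nearW => n; apply: le_trans (fle n); apply: ereal_inf_lbound; exists n => //=.
Qed.

End gaussian_second_moments.

(** * Functions whose sums over the coordinates concentrate *)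

Section concentrated.
Variable R : realType.
Local Notation N01 := (@normal_prob R 0 1).
Implicit Types g : R -> R.

(** [K] is chosen before the probability space, the dimension and the correlations, so it depends on
    [g] alone. *)
Definition concentrated g := bounded_measurable g /\
  exists K : R, 0 <= K /\
  forall (dT : measure_display) (T : measurableType dT) (P : probability T R)
    (d : nat) (xi : 'I_d -> T -> R) (rho : 'I_d -> 'I_d -> R),
    gaussian_pairs P xi rho ->
    \int[P]_w ((\sum_i (g (xi i w) - \int[N01]_x g x)) ^+ 2) <=
      K * \sum_i \sum_k rho i k ^+ 2.

Lemma bounded_measurable_comp_sum dT (T : measurableType dT) d
    (xi : 'I_d -> T -> R) g (r : R) :
  (forall i, measurable_fun setT (xi i)) -> bounded_measurable g ->
  bounded_measurable (fun w => \sum_i (g (xi i w) - r)).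
Proof.
move=> mxi [mg [M gM]]; apply: bounded_measurable_sum => i.
apply: bounded_measurableB; last exact: bounded_measurable_cst.
split; first exact: measurableT_comp.
by exists M => w.
Qed.

Lemma concentratedD g1 g2 : concentrated g1 -> concentrated g2 ->
  concentrated (fun x => g1 x + g2 x).
Proof.
move=> [b1 [K1 [K10 h1]]] [b2 [K2 [K20 h2]]]; split; first exact: bounded_measurableD.
exists (2 * K1 + 2 * K2); split; first by rewrite addr_ge0 ?mulr_ge0.
move=> dT T P d xi rho G; have [mxi _ _] := G.
have := h1 _ _ _ _ _ _ G; have := h2 _ _ _ _ _ _ G.
rewrite RintegralD//; [|exact: bounded_measurable_integrable..].
set m1 := \int[N01]_x g1 x; set m2 := \int[N01]_x g2 x => H2 H1.
have c1 := bounded_measurable_comp_sum m1 mxi b1.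
have c2 := bounded_measurable_comp_sum m2 mxi b2.
have s1 := bounded_measurableM c1 c1; have s2 := bounded_measurableM c2 c2.
have bc (r : R) (f : T -> R) : bounded_measurable f -> bounded_measurable (fun w => r * f w).
  by apply: bounded_measurableM; exact: bounded_measurable_cst.
apply: (@le_trans _ _ (\int[P]_w (2 * ((\sum_i (g1 (xi i w) - m1)) * (\sum_i (g1 (xi i w) - m1))) +
    2 * ((\sum_i (g2 (xi i w) - m2)) * (\sum_i (g2 (xi i w) - m2)))))).
  have sE w : \sum_i (g1 (xi i w) + g2 (xi i w) - (m1 + m2)) =
      \sum_i (g1 (xi i w) - m1) + \sum_i (g2 (xi i w) - m2).
    by rewrite -big_split/=; apply: eq_bigr => i _; ring.
  apply: le_Rintegral => //.
  - apply: bounded_measurable_integrable; under eq_fun do rewrite sE expr2.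
    by apply: bounded_measurableM; exact: bounded_measurableD.
  - by apply: bounded_measurable_integrable; apply: bounded_measurableD; exact: bc.
  - move=> w _; rewrite sE; set A := \sum_i _; set B := \sum_i _.
    by have := sqr_ge0 (A - B); nra.
rewrite RintegralD//; [|by apply: bounded_measurable_integrable; exact: bc..].
rewrite !RintegralZl//; [|exact: bounded_measurable_integrable..].
under eq_Rintegral do rewrite -expr2.
under [in X in _ + X]eq_Rintegral do rewrite -expr2.
set S := \sum_i \sum_k rho i k ^+ 2 in H1 H2 *.
have -> : (2 * K1 + 2 * K2) * S = 2 * (K1 * S) + 2 * (K2 * S) by ring.
by rewrite lerD// ler_pM2l.
Qed.

Lemma concentratedZ (r : R) g : concentrated g -> concentrated (fun x => r * g x).
Proof.
move=> [b [K [K0 h]]]; split.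
  by apply: bounded_measurableM => //; exact: bounded_measurable_cst.
exists (r ^+ 2 * K); split; first by rewrite mulr_ge0 ?sqr_ge0.
move=> dT T P d xi rho G; have [mxi _ _] := G.
have := h _ _ _ _ _ _ G.
rewrite RintegralZl//; last exact: bounded_measurable_integrable.
set m := \int[N01]_x g x => H.
have c := bounded_measurable_comp_sum m mxi b.
have -> : \int[P]_w ((\sum_i (r * g (xi i w) - r * m)) ^+ 2) =
   r ^+ 2 * \int[P]_w ((\sum_i (g (xi i w) - m)) ^+ 2).
  rewrite -RintegralZl//; last first.
    apply: bounded_measurable_integrable; under eq_fun do rewrite expr2.
    exact: bounded_measurableM.
  apply: eq_Rintegral => w _; rewrite -exprMn mulr_sumr; congr (_ ^+ 2).
  by apply: eq_bigr => i _; rewrite mulrBr.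
by rewrite -mulrA ler_wpM2l ?sqr_ge0.
Qed.

Lemma concentrated_cos u : concentrated (fun x => cos (u * x)).
Proof.
split; first by apply: bounded_measurable_cos; exact: measurable_funM.
exists ((u ^+ 2) ^+ 2 / 2); split; first by rewrite divr_ge0 ?sqr_ge0.
move=> dT T P d xi rho G.
have -> : \int[N01]_x cos (u * x) = cos 0 * expR (- u ^+ 2 / 2).
  by rewrite -Rintegral_normal_cos; apply: eq_Rintegral => x _; rewrite add0r.
have := second_moment_cos_sum G (fun=> 0) u.
rewrite (_ : \sum_i \sum_k (`|sin 0| * `|sin 0| * `|rho i k|) = 0); last first.
  by rewrite big1// => i _; rewrite big1// => k _; rewrite sin0 normr0 !mul0r.
rewrite mulr0 addr0; apply: le_trans.
by rewrite le_eqVlt; apply/orP; left; apply/eqP; apply: eq_Rintegral => w _; congr (_ ^+ 2);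
  apply: eq_bigr => i _; rewrite add0r.
Qed.

(* Products of cosines stay linear combinations of cosines, so this class,
   unlike [concentrated], is stable under multiplication by [cos (u * x)]. *)
Let trig u g := forall k : nat, concentrated (fun x => g x * cos (k%:R * u * x)).

Let trig1 u : trig u (fun=> 1).
Proof. by move=> k; under eq_fun do rewrite mul1r; exact: concentrated_cos. Qed.

(** The product-to-sum formula moves the index [k] by one in each direction; index 0 is treated
    apart, having no predecessor. *)
Let trigM u g : trig u g -> trig u (fun x => g x * ((1 - cos (u * x)) / 2)).
Proof.
move=> tg [|k].
  have -> : (fun x => g x * ((1 - cos (u * x)) / 2) * cos (0%:R * u * x)) =
      (fun x => 2^-1 * (g x * cos (0%:R * u * x)) + (- 2^-1) * (g x * cos (1%:R * u * x))).
    by apply/funext => x; rewrite !mul0r cos0 mul1r; field.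
  by apply: concentratedD; apply: concentratedZ; exact: tg.
have -> : (fun x => g x * ((1 - cos (u * x)) / 2) * cos (k.+1%:R * u * x)) =
    (fun x => 2^-1 * (g x * cos (k.+1%:R * u * x)) +
       ((- 4^-1) * (g x * cos (k.+2%:R * u * x)) + (- 4^-1) * (g x * cos (k%:R * u * x)))).
  apply/funext => x.
  have -> : k.+2%:R * u * x = k.+1%:R * u * x + u * x by rewrite -[k.+2]addn1 natrD; ring.
  have -> : k%:R * u * x = k.+1%:R * u * x - u * x by rewrite -[k.+1]addn1 natrD; ring.
  by rewrite cosD cosB; field.
by do ![apply: concentratedD|apply: concentratedZ|exact: tg].
Qed.

Let trigMX u g n : trig u g -> trig u (fun x => g x * ((1 - cos (u * x)) / 2) ^+ n).
Proof.
elim: n => [|n IH] tg.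
  by rewrite (_ : (fun x => _) = g)//; apply/funext => x; rewrite expr0 mulr1.
rewrite (_ : (fun x => _) = (fun x => g x * ((1 - cos (u * x)) / 2) ^+ n * ((1 - cos (u * x)) / 2))).
  by apply: trigM; exact: IH.
by apply/funext => x; rewrite exprS; ring.
Qed.

Let trig_onemX u n k : trig u (fun x => (1 - ((1 - cos (u * x)) / 2) ^+ n) ^+ k).
Proof.
elim: k => [|k IH].
  by under eq_fun do rewrite expr0; exact: trig1.
move=> j; have h1 := IH j; have h2 := trigMX n IH j.
rewrite (_ : (fun x => _) = (fun x => (1 - ((1 - cos (u * x)) / 2) ^+ n) ^+ k * cos (j%:R * u * x) +
    (- 1) * ((1 - ((1 - cos (u * x)) / 2) ^+ n) ^+ k * ((1 - cos (u * x)) / 2) ^+ n * cos (j%:R * u * x)))).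
  exact: (concentratedD h1 (concentratedZ (-1) h2)).
by apply/funext => x; rewrite exprS; ring.
Qed.

(** Since (1 - cos(u x))/2 = sin^2(u x/2), these functions can be made to fall steeply from nearly 1
    to nearly 0, which is how indicators will be approximated. *)
Lemma concentrated_onemX u n k :
  concentrated (fun x => (1 - ((1 - cos (u * x)) / 2) ^+ n) ^+ k).
Proof.
have := trig_onemX u n k 0; rewrite (_ : (fun x => _ * _) = (fun x => (1 - ((1 - cos (u * x)) / 2) ^+ n) ^+ k))//.
by apply/funext => x; rewrite !mul0r cos0 mulr1.
Qed.

End concentrated.

(** * The chi-square distribution function *)

Section chi2_cdf.
Variable R : realType.
Local Notation N01 := (@normal_prob R 0 1).
Local Notation F := (@chi2_1_cdf R).
Implicit Types x y : R.

Lemma measurable_sqr_le x : measurable [set z : R | z ^+ 2 <= x].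
Proof.
have m2 : measurable_fun setT (fun z : R => z ^+ 2) by exact: measurable_funX.
have := m2 measurableT [set` `]-oo, x]] (measurable_itv _).
by rewrite setTI; congr measurable; apply/seteqP.
Qed.

Lemma chi2_1_cdf_le x y : x <= y -> F x <= F y.
Proof.
move=> xy; apply: fine_le; rewrite ?fin_num_measure//; try exact: measurable_sqr_le.
apply: le_measure; rewrite ?inE; try exact: measurable_sqr_le.
by move=> z /=/le_trans; exact.
Qed.

Let pdf := @normal_pdf R 0 1.

Let pdfE : pdf = (fun x => normal_peak 1 * expR (- x ^+ 2 / 2)).
Proof.
rewrite /pdf normal_pdfE ?oner_eq0//; apply/funext => x.
by rewrite /normal_fun subr0 expr1n.
Qed.

(** The density is at most 1/2 because pi >= 2, and sqrt(1/5) <= 9/20. As 9/20 < 1/2, quantiles of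
    order at least 1/2 are at least 1/5; as 3/16 < 1/5, few xi_i^2 should fall below 3/16. *)
Lemma chi2_1_cdf_fifth : F (5^-1) <= 9 / 20.
Proof.
pose a : R := Num.sqrt 5^-1.
have a0 : 0 <= a by exact: sqrtr_ge0.
have a2 : a ^+ 2 = 5^-1 by rewrite sqr_sqrtr// invr_ge0.
have peak : normal_peak 1 <= 2^-1 :> R.
  rewrite /normal_peak expr1n mul1r lef_pV2 ?posrE//; last first.
    by rewrite sqrtr_gt0 pmulrn_lgt0// pi_gt0.
  rewrite -ler_sqr ?nnegrE ?sqrtr_ge0// sqr_sqrtr; last by apply: mulrn_wge0; exact: pi_ge0.
  by have := pi_ge2 R; rewrite mulr2n expr2; lra.
rewrite /chi2_1_cdf.
have -> : [set z : R | z ^+ 2 <= 5^-1] = `[- a, a]%classic.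
  apply/seteqP; split => z /=; rewrite in_itv/= -ler_norml -a2 -(real_normK (num_real z)) ler_sqr//.
rewrite -lee_fin fineK; last by rewrite fin_num_measure//; exact: measurable_itv.
apply: (@le_trans _ _ (\int[lebesgue_measure]_(x in `[(- a)%R, a]) (2^-1)%R%:E)%E).
  apply: ge0_le_integral => //.
  - by move=> x _; rewrite lee_fin normal_pdf_ge0.
  - by apply/measurable_EFinP; apply: measurable_funTS; exact: measurable_normal_pdf.
  - by move=> x _; rewrite lee_fin (le_trans (normal_pdf_ub _ _ _)) ?oner_eq0.
rewrite integral_cst//= lebesgue_measure_itv/=.
case: ifPn => _; last by rewrite mule0 lee_fin; lra.
rewrite -EFinB -EFinM lee_fin opprK.
have : a <= 9 / 20; last by lra.
by rewrite -ler_sqr ?nnegrE// a2; lra.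
Qed.

(** The points with sqrt x < z <= sqrt y have positive mass, the density there being at least its
    value at sqrt y. *)
Lemma chi2_1_cdf_lt x y : 0 <= x -> x < y -> F x < F y.
Proof.
move=> x0 xy.
pose a := Num.sqrt x; pose b := Num.sqrt y.
have ab : a < b by rewrite ltr_sqrt// (le_lt_trans x0).
have a0 : 0 <= a by exact: sqrtr_ge0.
have b0 : 0 <= b by exact: sqrtr_ge0.
have aE : a ^+ 2 = x by rewrite sqr_sqrtr.
have bE : b ^+ 2 = y by rewrite sqr_sqrtr// (le_trans x0)// ltW.
have mI : measurable `]a, b]%classic by exact: measurable_itv.
have sub : [set z : R | z ^+ 2 <= x] `|` `]a, b]%classic `<=` [set z : R | z ^+ 2 <= y].
  move=> z /= [zx|]; first by rewrite (le_trans zx)// ltW.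
  rewrite in_itv/= => /andP[az zb]; rewrite -bE ler_sqr// nnegrE.
  by rewrite (le_trans a0)// ltW.
have disj : [set z : R | z ^+ 2 <= x] `&` `]a, b]%classic = set0.
  rewrite -subset0 => z /= [zx]; rewrite in_itv/= => /andP[az _].
  by move: zx; rewrite -aE leNgt ltr_sqr ?nnegrE ?(le_trans a0 (ltW az))// az.
have pos : (0 < N01 `]a, b]%classic)%E.
  apply: (@lt_le_trans _ _ (\int[lebesgue_measure]_(x in `]a, b]) (pdf b)%:E)%E).
    rewrite integral_cst//= lebesgue_measure_itv/= lte_fin ab -EFinB -EFinM lte_fin.
    by rewrite mulr_gt0 ?subr_gt0// pdfE mulr_gt0 ?expR_gt0// normal_peak_gt0 ?oner_eq0.
  apply: ge0_le_integral => //.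
  - by move=> z _; rewrite lee_fin normal_pdf_ge0.
  - by apply/measurable_EFinP; apply: measurable_funTS; exact: measurable_normal_pdf.
  - move=> z /=; rewrite in_itv/= => /andP[az zb]; rewrite lee_fin -/pdf pdfE.
    rewrite ler_wpM2l ?normal_peak_ge0// ler_expR !mulNr lerN2 ler_pM2r ?invr_gt0//.
    by rewrite ler_sqr// nnegrE (le_trans a0)// ltW.
have mx := measurable_sqr_le x; have my := measurable_sqr_le y.
have le : (N01 [set z | (z ^+ 2 <= x)%R] + N01 `]a, b]%classic <= N01 [set z | (z ^+ 2 <= y)%R])%E.
  rewrite -measureU//; apply: le_measure; rewrite ?inE//; exact: measurableU.
have fx : N01 [set z | z ^+ 2 <= x] \is a fin_num by exact: fin_num_measure.
have fy : N01 [set z | z ^+ 2 <= y] \is a fin_num by exact: fin_num_measure.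
have fI : N01 `]a, b]%classic \is a fin_num by exact: fin_num_measure.
move: le pos; rewrite /chi2_1_cdf -(fineK fx) -(fineK fy) -(fineK fI) -EFinD lee_fin lte_fin.
by rewrite !fineK//; lra.
Qed.

End chi2_cdf.

(** * Trigonometric majorants of indicators *)

Section majorant.
Variable R : realType.
Local Notation N01 := (@normal_prob R 0 1).
Local Notation F := (@chi2_1_cdf R).

Lemma measurable_sqr_gt (x : R) : measurable [set z : R | x < z ^+ 2].
Proof.
rewrite (_ : [set z : R | _] = ~` [set z | z ^+ 2 <= x]).
  by apply: measurableC; exact: measurable_sqr_le.
by apply/seteqP; split => z /=; [rewrite ltNge => /negP|move=> /negP; rewrite -ltNge].
Qed.

Let bernoulli_ge (t : R) k : 0 <= t -> 1 + k%:R * t <= (1 + t) ^+ k.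
Proof.
move=> t0; elim: k => [|k IH]; first by rewrite mul0r addr0 expr0.
rewrite exprS -natr1.
have t1 : 0 <= 1 + t by lra.
apply: le_trans (ler_wpM2l t1 IH).
by have := mulr_ge0 (mulr_ge0 (ler0n R k) t0) t0; nra.
Qed.

Let bernoulli_le (t : R) k : 0 <= t <= 1 -> 1 - k%:R * t <= (1 - t) ^+ k.
Proof.
move=> /andP[t0 t1]; elim: k => [|k IH]; first by rewrite mul0r subr0 expr0.
rewrite exprS -natr1.
have t1' : 0 <= 1 - t by lra.
apply: le_trans (ler_wpM2l t1' IH).
by have := mulr_ge0 (mulr_ge0 (ler0n R k) t0) t0; nra.
Qed.

(** Because (1 - t)^k (1 + t)^k = (1 - t^2)^k <= 1. *)
Let onemX_le (t : R) k : 0 <= t <= 1 -> (1 - t) ^+ k * (k%:R * t) <= 1.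
Proof.
move=> /andP[t0 t1].
have q0 : 0 <= (1 - t) ^+ k by rewrite exprn_ge0// subr_ge0.
apply: (@le_trans _ _ ((1 - t) ^+ k * (1 + t) ^+ k)).
  rewrite ler_wpM2l//; apply: le_trans (bernoulli_ge k t0).
  by rewrite lerDr.
by rewrite -exprMn exprn_ile1//; nra.
Qed.

Let normal_tail (e : R) : 0 < e ->
  exists M : nat, fine (N01 [set z | M%:R ^+ 2 < z ^+ 2]) <= e.
Proof.
move=> e0; pose A n := [set z : R | n%:R ^+ 2 < z ^+ 2].
have mA n : measurable (A n) by exact: measurable_sqr_gt.
have A0 : \bigcap_n A n = set0.
  rewrite -subset0 => z Az.
  have := Az (Num.truncn `|z|).+1 I; rewrite /A/= -(real_normK (num_real z)).
  by rewrite ltNge ler_sqr ?nnegrE// ltW// truncnS_gt.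
have := @nonincreasing_cvg_mu _ _ _ N01 A.
rewrite A0 measure0 => h.
have : (N01 \o A) x @[x --> \oo] --> 0%E.
  apply: h => //.
  - by rewrite ltey_eq fin_num_measure//; exact: mA.
  - move=> n m nm; apply/subsetPset => z; rewrite /A/=; apply: le_lt_trans.
    by rewrite ler_sqr ?nnegrE// ler_nat.
move/fine_cvgP => [_ /cvgrPdist_le /(_ e e0)[n _ hn]]; exists n.
have := hn n (leqnn n); rewrite /= sub0r normrN; apply: le_trans; exact: ler_norm.
Qed.

(** The device is that of an elementary proof of the Stone-Weierstrass theorem. If w <= a on one set
    and w >= b > a on another, then (1 - w^n)^K is near 1 on the first when K a^n is small and near
    0 on the second when K b^n is large; a < b allows both. Periodicity of w is harmful only beyond
    [M], where the normal mass is small. *)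
Lemma sqr_indicator_majorant (y y' e : R) : 0 < y -> y < y' -> 0 < e ->
  exists g : R -> R, [/\ concentrated g, forall x, 0 <= g x,
    forall x : R, x ^+ 2 <= y -> 1 <= g x & \int[N01]_x g x <= F y' + e].
Proof.
move=> y0 yy' e0.
have y'0 : 0 < y' by exact: lt_trans yy'.
have e20 : 0 < e / 2 by rewrite divr_gt0.
have [M0 tailM0] := normal_tail e20.
pose M : R := Num.max M0%:R (1 + y').
have M0M : M0%:R <= M by rewrite le_max lexx.
have Mpos : 0 < M by rewrite lt_max; apply/orP; right; lra.
have My' : y' <= M ^+ 2.
  have M1 : 1 + y' <= M by rewrite le_max lexx orbT.
  by nra.
have mB : measurable [set z : R | M ^+ 2 < z ^+ 2] by exact: measurable_sqr_gt.
have tailM : fine (N01 [set z | M ^+ 2 < z ^+ 2]) <= e / 2.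
  apply: le_trans tailM0.
  have mB0 : measurable [set z : R | M0%:R ^+ 2 < z ^+ 2] by exact: measurable_sqr_gt.
  apply: fine_le; rewrite ?fin_num_measure//.
  apply: le_measure; rewrite ?inE//.
  by move=> z /=; apply: le_lt_trans; rewrite ler_sqr ?nnegrE// ltW.
(* Half a period of the cosine reaches [M], so [w] is even and increasing on [0, M]. *)
pose u := pi / M; have u0 : 0 < u by rewrite divr_gt0// pi_gt0.
pose w x := (1 - cos (u * x)) / 2.
have w01 x : 0 <= w x <= 1.
  by have := cos_le1 (u * x); have := cos_geN1 (u * x); rewrite /w; lra.
have wn x : w x = w `|x|.
  by rewrite /w -[u in RHS]gtr0_norm// -normrM; case: (ger0P (u * x)) => _; rewrite ?cosN.
have inI p : 0 <= p -> p <= M -> u * p \in `[0, pi].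
  move=> p0 pM; rewrite in_itv/= (mulr_ge0 (ltW u0) p0)/=.
  by rewrite /u mulrAC ler_pdivrMr// ler_pM2l ?pi_gt0.
have w_lt p q : 0 <= p -> p < q -> q <= M -> w p < w q.
  move=> p0 pq qM; rewrite /w ltr_pM2r ?invr_gt0// ltrD2l ltrN2 ltr_cos ?ltr_pM2l//.
    by apply: inI => //; exact: le_trans (ltW pq) qM.
  by apply: inI => //; exact: le_trans p0 (ltW pq).
have w_le p q : 0 <= p -> p <= q -> q <= M -> w p <= w q.
  move=> p0; rewrite le_eqVlt => /predU1P[->//|pq] qM.
  by apply: ltW; exact: w_lt.
pose a := w (Num.sqrt y); pose b := w (Num.sqrt y').
have MsE : Num.sqrt (M ^+ 2) = M by rewrite sqrtr_sqr ger0_norm// ltW.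
have sM : Num.sqrt y' <= M by rewrite -MsE ler_wsqrtr.
have ab : a < b by apply: w_lt => //; rewrite ltr_sqrt.
have a0 : 0 <= a by have /andP[] := w01 (Num.sqrt y).
have b0 : 0 < b by exact: le_lt_trans ab.
have b1 : b <= 1 by have /andP[] := w01 (Num.sqrt y').
have small x : x ^+ 2 <= y -> w x <= a.
  move=> xy; rewrite wn; apply: w_le => //.
    by rewrite -sqrtr_sqr ler_wsqrtr.
  by apply: le_trans sM; rewrite ler_wsqrtr// ltW.
have large x : y' <= x ^+ 2 -> x ^+ 2 <= M ^+ 2 -> b <= w x.
  move=> yx xM; rewrite (wn x); apply: w_le => //.
    by rewrite -sqrtr_sqr ler_wsqrtr.
  by rewrite -MsE -sqrtr_sqr ler_wsqrtr.
(* Half of [e] pays for the tail and half for 2 eta; eta <= 1/2 ensures (1 + 2 eta)(1 - eta) >=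
   1. *)
pose eta := Num.min 2^-1 (e / 4).
have eta0 : 0 < eta by rewrite lt_min invr_gt0 ltr0n/= divr_gt0.
have eta12 : eta <= 2^-1 by rewrite ge_min lexx.
have etae : eta <= e / 4 by rewrite ge_min lexx orbT.
have r0 : 0 <= a / b by rewrite divr_ge0// ltW.
have r1 : `|a / b| < 1 by rewrite ger0_norm// ltr_pdivrMr// mul1r.
have e2 : 0 < eta ^+ 2 / 2 by rewrite divr_gt0// exprn_gt0.
have [n hn] : exists n, (a / b) ^+ n <= eta ^+ 2 / 2.
  have /cvgrPdist_le /(_ _ e2)[n _ hn] := cvg_expr r1.
  exists n; have := hn n (leqnn n); rewrite /= sub0r normrN; apply: le_trans; exact: ler_norm.
(* Of order 1/(eta b^n), which gives K b^n >= 1/eta, while the choice of [n] keeps K a^n <= eta. *)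
pose K := (Num.truncn (eta * b ^+ n)^-1).+1.
have bn0 : 0 < b ^+ n by rewrite exprn_gt0.
have bn1 : b ^+ n <= 1 by rewrite exprn_ile1// ltW.
have Kb : 1 <= eta * (K%:R * b ^+ n).
  have : (eta * b ^+ n)^-1 <= K%:R by rewrite ltW// truncnS_gt.
  by rewrite -[X in X <= _]mul1r ler_pdivrMr ?mulr_gt0// mulrCA.
have Ka : K%:R * a ^+ n <= eta.
  have KE : K%:R <= (eta * b ^+ n)^-1 + 1.
    by rewrite /K -natr1 lerD2r truncn_le// invr_ge0 ltW// mulr_gt0.
  apply: le_trans (ler_wpM2r (exprn_ge0 n a0) KE) _.
  have -> : a ^+ n = (a / b) ^+ n * b ^+ n by rewrite -exprMn divfK// gt_eqF.
  rewrite [leLHS](_ : _ = (a / b) ^+ n * (eta^-1 + b ^+ n)); last first.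
    by move: ((a / b) ^+ n) (b ^+ n) bn0 => p q q0; field; rewrite !gt_eqF.
  have ei : 1 <= eta^-1 by rewrite -invr1 lef_pV2 ?posrE//; lra.
  apply: (@le_trans _ _ (eta ^+ 2 / 2 * (2 * eta^-1))).
    rewrite ler_pM ?exprn_ge0//; last lra.
    by rewrite addr_ge0 ?invr_ge0 ?ltW.
  by rewrite le_eqVlt; apply/orP; left; apply/eqP; field; rewrite gt_eqF.
pose g x := (1 + 2 * eta) * (1 - w x ^+ n) ^+ K.
have wn01 x : 0 <= w x ^+ n <= 1.
  by have /andP[? ?] := w01 x; rewrite exprn_ge0//= exprn_ile1.
have q01 x : 0 <= (1 - w x ^+ n) ^+ K <= 1.
  by have /andP[? ?] := wn01 x; rewrite exprn_ge0 ?subr_ge0//= exprn_ile1 ?subr_ge0// lerBlDr lerDl.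
have cg : concentrated g by apply: concentratedZ; exact: concentrated_onemX.
exists g; split => //.
- by move=> x; have /andP[? ?] := q01 x; rewrite mulr_ge0//; lra.
- move=> x /small wa.
  have := bernoulli_le K (wn01 x).
  have : K%:R * w x ^+ n <= eta.
    apply: le_trans Ka; rewrite ler_wpM2l// lerXn2r// nnegrE//.
    by have /andP[] := w01 x.
  rewrite /g; set q := _ ^+ K; set p := _ * _ => h1 h2; nra.
pose A := [set z : R | z ^+ 2 <= y']; pose B := [set z : R | M ^+ 2 < z ^+ 2].
have mA : measurable A by exact: measurable_sqr_le.
(* On x^2 <= y' and on the tail, g <= 1 + 2 eta; in between, g <= (1 + 2 eta) eta <= 2 eta. *)
have gle x : g x <= \1_A x + (\1_B x + 2 * eta).
  have /andP[q0 q1] := q01 x.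
  have [xy|yx] := leP (x ^+ 2) y'.
    rewrite [\1_A x]indicE mem_set// /g.
    have : 0 <= \1_B x :> R by rewrite indicE.
    move: (\1_B x) => i i0; rewrite mulr1n; nra.
  have iA : 0 <= \1_A x :> R by rewrite indicE.
  have [xM|Mx] := leP (x ^+ 2) (M ^+ 2); last first.
    rewrite [\1_B x]indicE mem_set// /g mulr1n.
    by move: (\1_A x) iA => i i0; nra.
  have bw := large _ (ltW yx) xM.
  have iB : 0 <= \1_B x :> R by rewrite indicE.
  have qe : (1 - w x ^+ n) ^+ K <= eta.
    have := onemX_le K (wn01 x).
    have : K%:R * b ^+ n <= K%:R * w x ^+ n by rewrite ler_wpM2l// lerXn2r// ?nnegrE ltW// (lt_le_trans b0).
    move: q0; set q := _ ^+ K => q0 h1 h2.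
    have h3 : q * (K%:R * b ^+ n) <= 1 by apply: le_trans h2; rewrite ler_wpM2l.
    have : q * (eta * (K%:R * b ^+ n)) <= eta.
      by rewrite mulrCA -[leRHS]mulr1 ler_pM2l.
    by apply: le_trans; rewrite -[leLHS]mulr1 ler_wpM2l.
  rewrite /g; move: (\1_A x) (\1_B x) iA iB => i j i0 j0; nra.
have bi (C : set R) : measurable C -> bounded_measurable (\1_C : R -> R).
  exact: bounded_measurable_indic.
have bc : bounded_measurable (fun _ : R => 2 * eta) by exact: bounded_measurable_cst.
have bBc := bounded_measurableD (bi _ mB) bc.
have iE (C : set R) : measurable C -> \int[N01]_x \1_C x = fine (N01 C).
  by move=> mC; rewrite /Rintegral integral_indic// setIT.
apply: (@le_trans _ _ (\int[N01]_x (\1_A x + (\1_B x + 2 * eta)))).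
  apply: le_Rintegral => //.
  - by apply: bounded_measurable_integrable; case: cg.
  - by apply: bounded_measurable_integrable; apply: bounded_measurableD => //; exact: bi.
rewrite RintegralD//; [|by apply: bounded_measurable_integrable; exact: bi|exact: bounded_measurable_integrable].
rewrite RintegralD//; [|by apply: bounded_measurable_integrable; exact: bi|exact: bounded_measurable_integrable].
rewrite !iE// Rintegral_cst// (_ : fine (N01 setT) = 1); last first.
  by rewrite -[RHS]/(fine 1%E); congr fine; exact: probability_setT.
by rewrite /chi2_1_cdf -/A; move: tailM; rewrite -/B; lra.
Qed.

End majorant.

(** * Deterministic properties of the estimators *)

Section estimators.
Variable R : realType.
Local Notation F := (@chi2_1_cdf R).

Lemma card_classical_set (I : finType) (p : pred I) :
  #|[set i | p i]%classic| = #|[pred i | p i]|.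
Proof. by apply: eq_card => i; rewrite inE; apply/idP/idP => [/set_mem|/mem_set]. Qed.

Lemma card_natr (I : finType) (p : pred I) :
  #|[pred i | p i]|%:R = \sum_i (p i)%:R :> R.
Proof.
rewrite -sum1_card natr_sum [LHS]big_mkcond/=; apply: eq_bigr => i _.
by rewrite inE; case: (p i).
Qed.

Lemma chi2_1_cdf_le1 (x : R) : F x <= 1.
Proof.
rewrite /chi2_1_cdf -lee_fin fineK; last by rewrite fin_num_measure//; exact: measurable_sqr_le.
exact: (@probability_le1 _ _ _ (@normal_prob R 0 1) _ (measurable_sqr_le x)).
Qed.

(** The alternative 0 is [inf] of the empty set; division by it gives 0 again, so the bound on
    [sigmaS2] survives. *)
Lemma chi2_1_quantile_ge (p : R) : 2^-1 <= p ->
  chi2_1_quantile p = 0 \/ 5^-1 <= chi2_1_quantile p.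
Proof.
move=> p2; rewrite /chi2_1_quantile.
have [->|/eqP/set0P ne] := pselect ([set x : R | p <= chi2_1_cdf x] = set0).
  by left; rewrite inf0.
right; apply: lb_le_inf => // x /= px.
rewrite leNgt; apply/negP => x5.
by have := chi2_1_cdf_fifth R; have := chi2_1_cdf_le (ltW x5); lra.
Qed.

Lemma chi2_1_quantile_le (p x : R) : 2^-1 <= p -> p <= F x ->
  5^-1 <= chi2_1_quantile p <= x.
Proof.
move=> p2 px.
have lb : lbound [set x : R | p <= chi2_1_cdf x] 5^-1.
  move=> z /= pz; rewrite leNgt; apply/negP => z5.
  by have := chi2_1_cdf_fifth R; have := chi2_1_cdf_le (ltW z5); lra.
apply/andP; split; first by apply: lb_le_inf => //; exists x.
by apply: ge_inf => //; exists 5^-1.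
Qed.

Lemma norm_ln1D_le (y : R) : `|y| <= 2^-1 -> `|ln (1 + y)| <= 2 * `|y|.
Proof.
rewrite ler_norml => /andP[y1 y2].
have p0 : 0 < 1 + y by lra.
have up : ln (1 + y) <= y by apply: le_ln1Dx; lra.
have lo : y / (1 + y) <= ln (1 + y).
  have q0 : 0 < (1 + y)^-1 by rewrite invr_gt0.
  have : ln (1 + ((1 + y)^-1 - 1)) <= (1 + y)^-1 - 1 by apply: le_ln1Dx; lra.
  rewrite addrC subrK lnV// => h.
  have -> : y / (1 + y) = - ((1 + y)^-1 - 1) by field; rewrite gt_eqF.
  by lra.
rewrite ler_norml; apply/andP; split.
  apply: le_trans lo; rewrite lerNl -mulNr ler_pdivrMr//.
  by have := normr_ge0 y; case: (ger0P y) => ? _; nra.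
by apply: le_trans up _; have := ler_norm y; have := normr_ge0 y; lra.
Qed.

Variables (d : nat) (Yt : 'I_d -> R).
Hypothesis d0 : (0 < d)%N.

Let dR0 : 0 < d%:R :> R. Proof. by rewrite ltr0n. Qed.

Lemma FhatE t : Fhat Yt t = (\sum_i (Yt i ^+ 2 <= t)%R%:R) / d%:R.
Proof.
by rewrite /Fhat (card_classical_set (fun i => Yt i ^+ 2 <= t)) (card_natr (fun i => Yt i ^+ 2 <= t)).
Qed.

Lemma Fhat_le t t' : t <= t' -> Fhat Yt t <= Fhat Yt t'.
Proof.
move=> tt'; rewrite !FhatE ler_pM2r ?invr_gt0//; apply: ler_sum => i _.
rewrite ler_nat; case: (leP _ t) => // h.
by rewrite (le_trans h).
Qed.

Let dyadic := [set x : R | exists l : int, x = 2 ^ l /\ 2^-1 <= Fhat Yt x].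

Let dyadic_nonempty : dyadic !=set0.
Proof.
pose m := \sum_i Yt i ^+ 2.
have m0 : 0 <= m by apply: sumr_ge0 => i _; exact: sqr_ge0.
pose k := Num.bound m.
have mk : m <= 2 ^+ k.
  apply: le_trans (ltW (archi_boundP m0)) _; rewrite -/k -natrX ler_nat ltnW//.
  exact: ltn_expl.
exists (2 ^ (k%:Z)), k%:Z; split => //.
rewrite FhatE (eq_bigr (fun=> 1)); last first.
  move=> i _; rewrite (_ : _ <= _ = true)//; apply: le_trans mk.
  by rewrite /m (bigD1 i)//= lerDl sumr_ge0// => j _; exact: sqr_ge0.
rewrite sumr_const card_ord divff ?gt_eqF//.
by rewrite invf_le1// ler1n.
Qed.

Let dyadic_lb : lbound dyadic 0.
Proof. by move=> _ [l [-> _]]; rewrite exprz_ge0. Qed.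

Lemma t_hat_ge0 : 0 <= t_hat Yt.
Proof. exact: lb_le_inf dyadic_nonempty dyadic_lb. Qed.

(** Stated strictly above [t_hat] so as to include [t_hat] = 0, where the infimum is not
    attained. *)
Lemma Fhat_gt_t_hat x : t_hat Yt < x -> 2^-1 <= Fhat Yt x.
Proof.
move=> tx; have e0 : 0 < x - t_hat Yt by rewrite subr_gt0.
have hi : has_inf dyadic by split; [exact: dyadic_nonempty|exists 0; exact: dyadic_lb].
have [z [l [zl Fz]]] := inf_adherent e0 hi.
rewrite -/(t_hat Yt) addrC subrK => zx.
by rewrite (le_trans Fz)// Fhat_le// ltW.
Qed.

(** A positive infimum is a minimum: some member z lies below 2 [t_hat], so z/2 is not a member, and
    any smaller power of 2 is at most z/2. *)
Lemma t_hatP : 0 < t_hat Yt -> exists l : int,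
  [/\ t_hat Yt = 2 ^ l, 2^-1 <= Fhat Yt (t_hat Yt) & Fhat Yt (t_hat Yt / 2) < 2^-1].
Proof.
move=> t0.
have hi : has_inf dyadic by split; [exact: dyadic_nonempty|exists 0; exact: dyadic_lb].
have lbt z : dyadic z -> t_hat Yt <= z.
  by move=> Dz; apply: ge_inf => //; exists 0; exact: dyadic_lb.
have half l : 2 ^ (l - 1) = 2 ^ l / 2 :> R by rewrite expfzDr// exprN1.
have [z [l [zl Fz]]] := inf_adherent t0 hi.
rewrite -/(t_hat Yt) => zt.
have notD : ~ dyadic (z / 2).
  move=> /lbt; lra.
have Fh : Fhat Yt (z / 2) < 2^-1.
  rewrite ltNge; apply/negP => h; apply: notD; exists (l - 1); split => //.
  by rewrite half zl.
have tz : t_hat Yt = z.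
  apply/eqP; rewrite eq_le lbt; last by exists l.
  rewrite leNgt; apply/negP => tltz.
  have e0 : 0 < z - t_hat Yt by rewrite subr_gt0.
  have [z' [l' [zl' Fz']]] := inf_adherent e0 hi.
  rewrite -/(t_hat Yt) addrC subrK => z'z.
  have l'l : l' < l by move: z'z; rewrite zl zl' ltr_eXz2l// ltr1n.
  have : z' <= z / 2.
    rewrite zl zl' -half ler_eXz2l ?ltr1n//.
    by rewrite lerBrDr lezD1.
  move=> z'h; have := Fhat_le z'h; lra.
by exists l; rewrite tz; split.
Qed.

Lemma sigmaS2_bound t : 0 <= t -> 2^-1 <= Fhat Yt t ->
  exists r : R, [/\ sigmaS2 Yt t = r%:E, 0 <= r & r <= 5 * t].
Proof.
move=> t0 Ft; rewrite /sigmaS2.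
have -> : (Fhat Yt t == 0) = false by apply/negbTE; rewrite gt_eqF//; lra.
case: ifPn => _; first by exists 0; split => //; rewrite mulr_ge0.
exists (t / chi2_1_quantile (Fhat Yt t)); split => //.
  by have [->|h] := chi2_1_quantile_ge Ft; rewrite ?invr0 ?mulr0// divr_ge0//; lra.
have [->|h] := chi2_1_quantile_ge Ft; first by rewrite invr0 mulr0 mulr_ge0.
by rewrite ler_pdivrMr; [nra|lra].
Qed.

(** The last hypothesis bounds the quantile by 2t/sg, which is what keeps the truncation level 2
    sigma_S^2 above sg. *)
Lemma sigmaS2_ge t (sg : R) : 0 < t -> 0 < sg -> 2^-1 <= Fhat Yt t ->
  Fhat Yt t < F (2 * t / sg) ->
  exists r : R, sigmaS2 Yt t = r%:E /\ sg <= 2 * r.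
Proof.
move=> t0 sg0 Ft FF; rewrite /sigmaS2.
have -> : (Fhat Yt t == 0) = false by apply/negbTE; rewrite gt_eqF//; lra.
have -> : (Fhat Yt t == 1) = false.
  by apply/negbTE; rewrite lt_eqF//; have := chi2_1_cdf_le1 (2 * t / sg); lra.
exists (t / chi2_1_quantile (Fhat Yt t)); split => //.
have /andP[q0 q1] := chi2_1_quantile_le Ft (ltW FF).
move: q0 q1; set q := chi2_1_quantile _ => q0 q1.
have qpos : 0 < q by lra.
rewrite mulrA ler_pdivlMr//; move: q1; rewrite ler_pdivlMr//; lra.
Qed.

Variables (s : nat) (fro : R).

Let lam := lambda_D s fro.

Lemma lambda_D_ge : 6^-1 <= lambda_D s fro.
Proof. by rewrite /lambda_D -[X in X <= _]mul1r ler_pM2r ?invr_gt0// le_max lexx. Qed.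

Let lam0 : 0 < lam. Proof. by have := lambda_D_ge; rewrite -/lam; lra. Qed.

Let phi_le1 u : `|phi_hat Yt u| <= 1.
Proof.
rewrite /phi_hat normrM normfV (gtr0_norm dR0) ler_pdivrMr// mul1r.
apply: le_trans (ler_norm_sum _ _ _) _.
rewrite -[X in _ <= X%:R]card_ord -sum1_card natr_sum; apply: ler_sum => i _.
exact: cos_max.
Qed.

(** The truncation alone gives it: 10 = 2 * 5, with 1/5 the lower bound on the quantile. This also
    covers an infinite [sigmaD2_tilde]. *)
Lemma sigmaD2_hat_bound :
  exists r : R, [/\ sigmaD2_hat s fro Yt = r%:E, 0 <= r & r <= 10 * t_hat Yt].
Proof.
have tge := t_hat_ge0.
have tilde0 : (0 <= sigmaD2_tilde s fro Yt)%E.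
  rewrite /sigmaD2_tilde; case: ifPn => // ph0.
  rewrite lee_fin mulNr oppr_ge0 mulr_ge0_le0//.
    by apply: divr_ge0; [rewrite mulr_ge0|exact: ltW lam0].
  by apply: ln_le0; exact: phi_le1.
move: tge; rewrite le_eqVlt => /predU1P[t0|t0].
  (* Division by zero makes the frequency 0, where the empirical characteristic function is 1 and
     its logarithm 0. *)
  exists 0; rewrite -t0 mulr0; split => //.
  rewrite /sigmaD2_hat.
  have -> : sigmaD2_tilde s fro Yt = 0%E.
    rewrite /sigmaD2_tilde -t0 invr0 mulr0 sqrtr0 /phi_hat.
    rewrite (eq_bigr (fun=> 1)); last by move=> i _; rewrite mul0r cos0.
    rewrite sumr_const card_ord divff ?gt_eqF// ?oner_eq0.
    by rewrite normr1 ln1 mulr0.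
  rewrite min_l// mule_ge0// /sigmaS2_hat /sigmaS2 -t0.
  by case: ifP => // _; case: ifP => // _; rewrite mul0r.
have [l [_ Ft _]] := t_hatP t0.
have [r [Sr r0 r5]] := sigmaS2_bound (ltW t0) Ft.
rewrite /sigmaD2_hat /sigmaS2_hat Sr -EFinM.
move: tilde0; case: (sigmaD2_tilde s fro Yt) => [x x0|_|//].
  exists (Num.min x (2 * r)); split => //.
  - by rewrite EFin_min.
  - by rewrite le_min -lee_fin x0 mulr_ge0.
  - by rewrite ge_min; apply/orP; right; lra.
exists (2 * r); split; first by rewrite min_r ?leey.
  by rewrite mulr_ge0.
lra.
Qed.

Lemma sigmaD2_hat_good (sg y : R) :
  0 < t_hat Yt -> 0 < sg ->
  Fhat Yt (t_hat Yt) < F (2 * t_hat Yt / sg) ->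
  `|y| <= 2^-1 ->
  phi_hat Yt (Num.sqrt (lam / t_hat Yt)) =
    expR (- (lam / t_hat Yt * sg) / 2) * (1 + y) ->
  exists r : R, sigmaD2_hat s fro Yt = r%:E /\
    `|r - sg| <= 4 * t_hat Yt / lam * `|y|.
Proof.
move=> t0 sg0 FF y2 phE.
have [l [_ Ft _]] := t_hatP t0.
have [q [Sq q2]] := sigmaS2_ge t0 sg0 Ft FF.
set t := t_hat Yt in t0 FF phE Ft Sq *.
have y1 : 0 < 1 + y by move: y2; rewrite ler_norml => /andP[]; lra.
have ph0 : 0 < phi_hat Yt (Num.sqrt (lam / t)) by rewrite phE mulr_gt0 ?expR_gt0.
have tE : sigmaD2_tilde s fro Yt = (sg - 2 * t / lam * ln (1 + y))%:E.
  rewrite /sigmaD2_tilde -/t -/lam (gt_eqF ph0); congr EFin.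
  rewrite gtr0_norm// phE lnM ?posrE ?expR_gt0// expRK.
  by field; rewrite !gt_eqF.
exists (Num.min (sg - 2 * t / lam * ln (1 + y)) (2 * q)); split.
  by rewrite /sigmaD2_hat /sigmaS2_hat -/t Sq tE -EFinM EFin_min.
have ln2 := norm_ln1D_le y2.
have c0 : 0 <= 2 * t / lam.
  by apply: divr_ge0; [rewrite mulr_ge0// ltW|exact: ltW].
have b : `|2 * t / lam * ln (1 + y)| <= 4 * t / lam * `|y|.
  rewrite normrM (ger0_norm c0) (_ : 4 * t / lam * `|y| = 2 * t / lam * (2 * `|y|)); last by ring.
  by rewrite ler_wpM2l.
apply: le_trans b.
move: (2 * t / lam * ln (1 + y)) => z.
(* If the truncation is active, then sg <= 2q < sg - z, so it only moves the estimate towards sg. *)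
have [h|h] := leP (sg - z) (2 * q); first by rewrite addrAC subrr add0r normrN.
rewrite ger0_norm ?subr_ge0//.
by have := ler_norm (- z); rewrite normrN; lra.
Qed.

End estimators.

(** * Events detected by a test of small mean *)

Section detectable.
Variable R : realType.
Local Notation N01 := (@normal_prob R 0 1).
Local Notation F := (@chi2_1_cdf R).

(** [x] stands for the noise vector and [nu] for the number of perturbed coordinates. Only the test
    [q] is integrated; it depends on neither [nu] nor the law of the noise. *)
Definition detectable (B : forall d, ('I_d -> R) -> R -> Prop) :=
  exists c K : R, exists q : forall d, ('I_d -> R) -> R,
  [/\ 0 < c, 0 <= K, forall d x, 0 <= q d x,
      forall d (x : 'I_d -> R) nu, (0 < d)%N -> nu <= c * d%:R -> B d x nu -> 1 <= q d x &
      forall (dT : measure_display) (T : measurableType dT) (P : probability T R)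
        (d : nat) (xi : 'I_d -> T -> R) (rho : 'I_d -> 'I_d -> R),
        gaussian_pairs P xi rho ->
        bounded_measurable (fun w => q d (xi^~ w)) /\
        \int[P]_w q d (xi^~ w) <= K * (\sum_i \sum_k rho i k ^+ 2) / d%:R ^+ 2].

Lemma detectableU (B1 B2 : forall d, ('I_d -> R) -> R -> Prop) :
  detectable B1 -> detectable B2 ->
  detectable (fun d x nu => B1 d x nu \/ B2 d x nu).
Proof.
move=> [c1 [K1 [q1 [c10 K10 q10 B1q E1]]]] [c2 [K2 [q2 [c20 K20 q20 B2q E2]]]].
exists (Num.min c1 c2), (K1 + K2), (fun d x => q1 d x + q2 d x); split.
- by rewrite lt_min c10.
- exact: addr_ge0.
- by move=> d x; rewrite addr_ge0.
- move=> d x nu d0 nuc [b|b].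
    have h : nu <= c1 * d%:R by apply: le_trans nuc _; rewrite ler_wpM2r// ge_min lexx.
    by have := B1q d x nu d0 h b; have := q20 d x; lra.
  have h : nu <= c2 * d%:R by apply: le_trans nuc _; rewrite ler_wpM2r// ge_min lexx orbT.
  by have := B2q d x nu d0 h b; have := q10 d x; lra.
- move=> dT T P d xi rho G.
  have [b1 e1] := E1 _ _ _ _ _ _ G; have [b2 e2] := E2 _ _ _ _ _ _ G.
  split; first exact: bounded_measurableD.
  rewrite RintegralD//; [|exact: bounded_measurable_integrable..].
  by rewrite mulrDl mulrDl lerD.
Qed.

Lemma detectable_sub (B1 B2 : forall d, ('I_d -> R) -> R -> Prop) :
  (forall d x nu, (0 < d)%N -> B2 d x nu -> B1 d x nu) -> detectable B1 -> detectable B2.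
Proof.
move=> B21 [c [K [q [c0 K0 q0 Bq E]]]]; exists c, K, q; split => //.
by move=> d x nu d0 nuc b; apply: (Bq d x nu) => //; exact: B21.
Qed.

(** Chebyshev's inequality for a majorant of the indicator. With [e] a quarter of the gap between
    [Phi] and [F y'], one [e] is spent on the mean of the majorant and one on [nu]; the remaining
    deviation exceeds e d. *)
Lemma detectable_small (y y' Phi : R) : 0 < y -> y < y' -> F y' < Phi ->
  detectable (fun d x nu => Phi * d%:R <= \sum_i (x i ^+ 2 <= y)%R%:R + nu).
Proof.
move=> y0 yy' FP; pose e := (Phi - F y') / 4.
have e0 : 0 < e by rewrite divr_gt0// subr_gt0.
have [g [[bg [K [K0 Kg]]] g0 g1 gF]] := sqr_indicator_majorant y0 yy' e0.
move: gF Kg; set m := \int[N01]_x g x => gF Kg.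
exists e, (K / e ^+ 2), (fun d x => (\sum_i (g (x i) - m)) ^+ 2 / (e * d%:R) ^+ 2); split => //.
- by rewrite divr_ge0 ?sqr_ge0.
- by move=> d x; rewrite divr_ge0 ?sqr_ge0.
- move=> d x nu d0 nue b.
  have d0R : 0 < d%:R :> R by rewrite ltr0n.
  have ed0 : 0 < e * d%:R by rewrite mulr_gt0.
  have h : e * d%:R <= \sum_i (g (x i) - m).
    have gs : \sum_i (x i ^+ 2 <= y)%R%:R <= \sum_i g (x i).
      by apply: ler_sum => i _; case: (leP _ y) => [/g1//|_]; exact: g0.
    rewrite big_split/= sumr_const card_ord -mulr_natr.
    have : m * d%:R <= (F y' + e) * d%:R by rewrite ler_wpM2r.
    have eE : Phi = F y' + 4 * e by rewrite /e; field.
    rewrite eE in b; move: b gs nue.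
    set S1 := \sum_i _; set S2 := \sum_i _; move: (F y') => f; nra.
  rewrite ler_pdivlMr; last by rewrite exprn_gt0.
  by rewrite mul1r ler_sqr ?nnegrE ?(ltW ed0)// (le_trans (ltW ed0)).
- move=> dT T P d xi rho G; have [mxi _ _] := G.
  have bs := bounded_measurable_comp_sum m mxi bg.
  have bs2 : bounded_measurable (fun w => (\sum_i (g (xi i w) - m)) ^+ 2).
    by under eq_fun do rewrite expr2; exact: bounded_measurableM.
  split.
    by apply: bounded_measurableM => //; exact: bounded_measurable_cst.
  rewrite RintegralZr//; last exact: bounded_measurable_integrable.
  have := Kg _ _ _ _ _ _ G; set I := \int[P]_w _; set S := \sum_i _ => IK.
  rewrite exprMn invfM mulrA (mulrAC K) ler_wpM2r ?invr_ge0 ?sqr_ge0//.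
  by rewrite ler_wpM2r ?invr_ge0 ?sqr_ge0.
Qed.

(** Uniformity in y comes from a geometric grid of ratio 6/5: by monotonicity, the count at the
    upper neighbour is tested against the level at the lower one, and 6/5 < 3/2 < 2 leaves room for
    the majorant. *)
Lemma detectable_window (y0 : R) (J : nat) : 0 < y0 ->
  detectable (fun d x nu => exists y, [/\ y0 <= y, y <= y0 * (6 / 5) ^+ J &
    F (2 * y) * d%:R <= \sum_i (x i ^+ 2 <= y)%R%:R + nu]).
Proof.
move=> y00; elim: J => [|J IH].
  have h : detectable (fun d x nu => F (2 * y0) * d%:R <= \sum_i (x i ^+ 2 <= y0)%R%:R + nu).
    apply: (@detectable_small y0 (3 / 2 * y0)) => //; first by nra.
    by apply: chi2_1_cdf_lt; nra.
  apply: detectable_sub h => d x nu d0 [y []].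
  rewrite expr0 mulr1 => yl yu; suff -> : y = y0 by [].
  by apply/eqP; rewrite eq_le yl yu.
set yJ := y0 * (6 / 5) ^+ J in IH.
have yJ0 : 0 < yJ by rewrite mulr_gt0// exprn_gt0// divr_gt0.
have h : detectable (fun d x nu => F (2 * yJ) * d%:R <= \sum_i (x i ^+ 2 <= 6 / 5 * yJ)%R%:R + nu).
  apply: (@detectable_small _ (3 / 2 * yJ)) => //; [nra|nra|].
  by apply: chi2_1_cdf_lt; nra.
apply: detectable_sub (detectableU IH h) => d x nu d0 [y [yl yu b]].
have [yle|ylt] := leP y yJ; [left; exists y; split => //|right].
have yu' : y <= 6 / 5 * yJ by move: yu; rewrite exprS /yJ; nra.
apply: le_trans (_ : _ <= F (2 * y) * d%:R) _.
  by rewrite ler_wpM2r//; apply: chi2_1_cdf_le; lra.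
apply: le_trans b _; rewrite lerD2r; apply: ler_sum => i _.
rewrite ler_nat; case: (leP _ y) => // hy.
by rewrite (le_trans hy).
Qed.

End detectable.

(** * Amplified variance against the target rate *)

Section rate.
Variable R : realType.

Let expX_le_expR (n : nat) (x : R) : 0 <= x ->
  x ^+ n.+1 <= n.+1%:R ^+ n.+1 * expR x.
Proof.
move=> x0; have n0 : 0 < n.+1%:R :> R by rewrite ltr0n.
have -> : expR x = expR (x / n.+1%:R) ^+ n.+1.
  by rewrite -expRM_natl mulrC divfK// gt_eqF.
rewrite -exprMn lerXn2r ?nnegrE ?mulr_ge0 ?expR_ge0// ?(ltW n0)//.
rewrite -ler_pdivrMl// mulrC; apply: le_trans (expR_ge1Dx _).
by rewrite lerDr.
Qed.

(** If L = ln(s/f) >= 1, then s = f exp(L), and the target is at least f^2 exp(2L)/L^2. The term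
    exp(v) v s f is the critical one: it needs L^3 exp(v) = O(exp(L)), which v <= 8L/9 gives.
    Otherwise s <= 4f and v <= 1, and both sides are of order f^2 or the right one is larger. *)
Lemma variance_rate : exists C : R, 0 <= C /\ forall s f v : R,
  0 < s -> 0 < f -> 0 <= v -> v <= 8 / 9 * Num.max 1 (ln (s / f)) ->
  expR v * (v ^+ 2 * f ^+ 2 / 2 + v * (s * f)) <=
    C * (s / Num.max 1 (ln (s / f)) + f) ^+ 2.
Proof.
have [C3 [C30 cube]] : exists C3 : R, 0 <= C3 /\
    forall x : R, 0 <= x -> x ^+ 3 <= C3 * expR (x / 9).
  exists (9 ^+ 3 * 3 ^+ 3); split; first by rewrite mulr_ge0 ?exprn_ge0.
  move=> x x0; have x9 : 0 <= x / 9 by rewrite divr_ge0.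
  have -> : x ^+ 3 = 9 ^+ 3 * (x / 9) ^+ 3.
    by rewrite -exprMn mulrC divfK// pnatr_eq0.
  by rewrite -mulrA ler_wpM2l ?exprn_ge0//; exact: expX_le_expR.
have [C4 [C40 fourth]] : exists C4 : R, 0 <= C4 /\
    forall x : R, 0 <= x -> x ^+ 4 <= C4 * expR x.
  by exists (4 ^+ 4); split; [rewrite exprn_ge0|exact: expX_le_expR].
exists (C4 + C3 + 18); split; first by rewrite !addr_ge0.
move=> s f v s0 f0 v0.
case: (leP 1 (ln (s / f))) => L1 vL.
  set L := ln (s / f) in L1 vL *.
  have sE : s = f * expR L by rewrite /L lnK ?posrE ?divr_gt0//; field; rewrite gt_eqF.
  have L0 : 0 < L by lra.
  pose X := expR L; pose Y := expR (L / 9).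
  have X0 : 0 < X by exact: expR_gt0.
  have Y0 : 0 < Y by exact: expR_gt0.
  have ev : expR v * Y <= X by rewrite -expRD ler_expR; lra.
  have Y1 : 1 <= Y by rewrite -expR0 ler_expR divr_ge0// ltW.
  have h3 : L ^+ 3 <= C3 * Y by apply: cube; exact: ltW.
  have h4 : L ^+ 4 <= C4 * X by apply: fourth; exact: ltW.
  have E0 := expR_gt0 v.
  have vL' : v <= L by lra.
  apply: (@le_trans _ _ ((C4 + C3) * (s / L) ^+ 2)); last first.
    have sL0 : 0 <= s / L by exact: divr_ge0 (ltW s0) (ltW L0).
    have sLf : s / L <= s / L + f by rewrite lerDl ltW.
    apply: ler_pM; rewrite ?addr_ge0 ?sqr_ge0//; first by rewrite lerDl.
    by rewrite ler_sqr// nnegrE addr_ge0// ltW.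
  have -> : (s / L) ^+ 2 = f ^+ 2 * X ^+ 2 / L ^+ 2 by rewrite sE !exprMn exprVn.
  rewrite [leRHS]mulrA ler_pdivlMr ?exprn_gt0// sE -/X.
  have EX : expR v <= X by apply: le_trans ev; rewrite ler_peMr// ltW.
  have f2 : 0 < f ^+ 2 by rewrite exprn_gt0.
  have t1 : expR v * (v ^+ 2 * f ^+ 2 / 2) * L ^+ 2 <= C4 * (f ^+ 2 * X ^+ 2).
    have v2 : v ^+ 2 <= L ^+ 2 by rewrite ler_sqr ?nnegrE// ltW.
    have hh : v ^+ 2 * L ^+ 2 <= C4 * X.
      apply: le_trans h4; rewrite (_ : L ^+ 4 = L ^+ 2 * L ^+ 2); last by ring.
      by rewrite ler_wpM2r ?sqr_ge0.
    have h5 : expR v * (v ^+ 2 * L ^+ 2) <= X * (C4 * X).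
      by rewrite ler_pM ?mulr_ge0 ?sqr_ge0// ltW.
    have h6 := ler_wpM2l (ltW f2) h5.
    rewrite [leLHS](_ : _ = f ^+ 2 * (expR v * (v ^+ 2 * L ^+ 2)) / 2); last by ring.
    rewrite [leRHS](_ : _ = f ^+ 2 * (X * (C4 * X))); last by ring.
    apply: le_trans h6; rewrite ler_pdivrMr// ler_peMr ?ler1n//.
    by rewrite mulr_ge0 ?mulr_ge0 ?sqr_ge0// ltW.
  have t2 : expR v * (v * (f * X * f)) * L ^+ 2 <= C3 * (f ^+ 2 * X ^+ 2).
    have hh : v * L ^+ 2 <= C3 * Y.
      apply: le_trans h3; rewrite (_ : L ^+ 3 = L * L ^+ 2); last by ring.
      by rewrite ler_wpM2r ?sqr_ge0.
    have h5 : expR v * (v * L ^+ 2) <= C3 * X.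
      apply: (@le_trans _ _ (expR v * (C3 * Y))); first by rewrite ler_pM2l.
      by rewrite mulrCA ler_wpM2l.
    have fX : 0 <= f ^+ 2 * X by rewrite mulr_ge0 ?sqr_ge0// ltW.
    have h6 := ler_wpM2l fX h5.
    rewrite [leLHS](_ : _ = f ^+ 2 * X * (expR v * (v * L ^+ 2))); last by ring.
    by rewrite [leRHS](_ : _ = f ^+ 2 * X * (C3 * X)); last by ring.
  have := lerD t1 t2.
  rewrite [X in X <= _ -> _](_ : _ =
    expR v * (v ^+ 2 * f ^+ 2 / 2 + v * (f * X * f)) * L ^+ 2); last by ring.
  by rewrite -mulrDl mulrA.
have e4 : expR 1 <= 4 :> R.
  have h : 2^-1 <= expR (- (2^-1)) :> R by apply: le_trans (expR_ge1Dx _); lra.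
  have -> : expR 1 = (expR (- (2^-1)) ^+ 2)^-1 :> R.
    by rewrite -expRM_natl -expRN; congr expR; field.
  rewrite -[leRHS]invrK lef_pV2 ?posrE ?exprn_gt0 ?expR_gt0 ?invr_gt0//.
  by rewrite (_ : 4^-1 = (2^-1) ^+ 2) ?ler_sqr ?nnegrE ?expR_ge0//; field.
have sf : s <= 4 * f.
  have : s / f <= expR 1 by rewrite -[s / f]lnK ?posrE ?divr_gt0// ler_expR ltW.
  by rewrite ler_pdivrMr// => h; apply: le_trans h _; rewrite ler_pM2r.
have v1 : v <= 1 by clear -vL; lra.
have ev : expR v <= 4 by apply: le_trans e4; rewrite ler_expR.
apply: (@le_trans _ _ (4 * (f ^+ 2 / 2 + 4 * f ^+ 2))).
  have v2 : v ^+ 2 * f ^+ 2 <= f ^+ 2 by rewrite ler_piMl ?sqr_ge0// exprn_ile1.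
  have vsf : v * (s * f) <= 4 * f ^+ 2.
    apply: (@le_trans _ _ (s * f)); first by rewrite ler_piMl// mulr_ge0// ltW.
    by rewrite expr2 mulrA ler_pM2r.
  rewrite ler_pM ?expR_ge0//; last by lra.
  by rewrite addr_ge0 ?divr_ge0 ?mulr_ge0 ?sqr_ge0// ltW.
rewrite divr1; apply: (@le_trans _ _ (18 * (s + f) ^+ 2)); last first.
  by rewrite ler_wpM2r ?sqr_ge0// lerDr addr_ge0.
clear -s0 f0; have := exprn_gt0 2 f0; have := mulr_gt0 s0 f0; have := sqr_ge0 s.
have -> : (s + f) ^+ 2 = s ^+ 2 + 2 * (s * f) + f ^+ 2 by ring.
by lra.
Qed.

End rate.

(** * Deterministic error bound for one realisation *)

Section pointwise.
Variable R : realType.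
Local Notation F := (@chi2_1_cdf R).

Lemma dyadic_between (x : R) : 0 < x -> exists l : int, x <= 2 ^ l /\ 2 ^ l < 2 * x.
Proof.
move=> x0; pose k := Num.bound x^-1; pose m := Num.bound x.
have xi0 : 0 <= x^-1 by rewrite invr_ge0 ltW.
have k2 : (2 ^+ k)^-1 <= x.
  rewrite -[leRHS]invrK lef_pV2 ?posrE ?invr_gt0 ?exprn_gt0//.
  apply: le_trans (ltW (archi_boundP xi0)) _; rewrite -/k -natrX ler_nat ltnW//.
  exact: ltn_expl.
have ex : exists n, x <= 2 ^ (n%:Z - k%:Z).
  exists (m + k)%N; rewrite PoszD addrK.
  apply: le_trans (ltW (archi_boundP (ltW x0))) _; rewrite -/m -exprnP -natrX ler_nat ltnW//.
  exact: ltn_expl.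
case: (ex_minnP ex) => [[|n] xn min].
  exists (0%:Z - k%:Z); split => //; rewrite sub0r -exprnN.
  by move: xn; rewrite sub0r -exprnN; lra.
exists (n.+1%:Z - k%:Z); split => //.
have : ~~ (x <= 2 ^ (n%:Z - k%:Z)).
  by apply/negP => /min; rewrite ltnn.
rewrite -ltNge => h; rewrite (_ : n.+1%:Z - k%:Z = (n%:Z - k%:Z) + 1); last by rewrite intS; ring.
rewrite expfzDr// expr1z mulrC.
by rewrite ltr_pM2l.
Qed.

Variables (d s : nat) (fro sigma : R) (mu xi : 'I_d -> R).
Hypotheses (d0 : (0 < d)%N) (sigma0 : 0 < sigma).
Hypothesis mus : (#|[pred i | mu i != 0%R]| <= s)%N.
Hypothesis sd : s%:R <= 16^-1 * d%:R :> R.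

Let Yt i := mu i + sigma * xi i.
Let U := (\sum_i (xi i ^+ 2 - 1)) / d%:R.
Let t := t_hat Yt.
Let lam := lambda_D s fro.
Let L := Num.max 1 (ln (s%:R / fro)).

Let dR0 : 0 < d%:R :> R. Proof. by rewrite ltr0n. Qed.
Let lamE : lam = L / 6. Proof. by []. Qed.
Let L1 : 1 <= L. Proof. by rewrite le_max lexx. Qed.
Let sg0 : 0 < sigma ^+ 2. Proof. by rewrite exprn_gt0. Qed.

Let mus_sum : \sum_i (mu i != 0)%:R <= s%:R :> R.
Proof. by rewrite -(card_natr R (fun i => mu i != 0)) ler_nat. Qed.

Let sum_xi2 : \sum_i xi i ^+ 2 = d%:R * (1 + U).
Proof.
rewrite /U mulrDr mulr1 mulrC divfK ?gt_eqF// sumrB sumr_const card_ord.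
by rewrite addrC subrK.
Qed.

Let U_ge : 0 <= 1 + U.
Proof.
by rewrite -(pmulr_rge0 _ dR0) -sum_xi2 sumr_ge0// => i _; exact: sqr_ge0.
Qed.

Let count_le x : \sum_i (Yt i ^+ 2 <= x)%R%:R <=
  \sum_i (xi i ^+ 2 <= x / sigma ^+ 2)%R%:R + s%:R :> R.
Proof.
apply: le_trans (_ : _ <= \sum_i (xi i ^+ 2 <= x / sigma ^+ 2)%R%:R + \sum_i (mu i != 0)%:R) _; last first.
  by rewrite lerD2l.
rewrite -big_split/=; apply: ler_sum => i _; rewrite -natrD ler_nat.
have [mu0|] := eqVneq (mu i) 0; last by rewrite addn1; case: (_ <= x).
rewrite /Yt mu0 add0r exprMn ler_pdivlMr// mulrC addn0.
by case: (_ <= x).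
Qed.

Let FhatM x : Fhat Yt x * d%:R = \sum_i (Yt i ^+ 2 <= x)%R%:R.
Proof. by rewrite FhatE divfK// gt_eqF. Qed.

(** Fewer than d/2 of the squares are at most t/2 and at most d/16 coordinates are perturbed, so at
    least d/4 of the xi_i^2 exceed t/(2 sigma^2). Markov's inequality for their mean 1 + U gives the
    factor 8. *)
Let t_hat_le : t <= 8 * sigma ^+ 2 * (1 + U).
Proof.
have := t_hat_ge0 Yt d0; rewrite -/t le_eqVlt => /predU1P[<-|t0].
  by rewrite mulr_ge0// mulr_ge0// ltW.
have [l [_ _ Fh]] := t_hatP d0 t0.
have Fh' : \sum_i (Yt i ^+ 2 <= t / 2)%R%:R < 2^-1 * d%:R :> R.
  by rewrite -FhatM ltr_pM2r.
have st0 : 0 <= 2 * sigma ^+ 2 / t.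
  by apply: divr_ge0; [rewrite mulr_ge0// ltW|exact: ltW].
have cnt : d%:R <= \sum_i (Yt i ^+ 2 <= t / 2)%R%:R + (s%:R + 2 * sigma ^+ 2 / t * (d%:R * (1 + U))).
  apply: le_trans (_ : _ <= \sum_i (Yt i ^+ 2 <= t / 2)%R%:R +
      (\sum_i (mu i != 0)%:R + 2 * sigma ^+ 2 / t * \sum_i xi i ^+ 2)) _; last first.
    by rewrite sum_xi2 lerD2l lerD2r.
  rewrite mulr_sumr -!big_split/= -[X in X%:R <= _]card_ord -sum1_card natr_sum.
  apply: ler_sum => i _.
  have x0 : 0 <= 2 * sigma ^+ 2 / t * xi i ^+ 2 by rewrite mulr_ge0 ?sqr_ge0.
  have [//|h] := leP (Yt i ^+ 2) (t / 2); first by rewrite lerDl addr_ge0.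
  rewrite add0r; have [mu0|_] := eqVneq (mu i) 0; last by rewrite lerDl.
  rewrite add0r; move: h; rewrite /Yt mu0 add0r exprMn => h.
  rewrite mulrAC ler_pdivlMr// mul1r; lra.
have h : 4^-1 * d%:R <= 2 * sigma ^+ 2 / t * (d%:R * (1 + U)).
  move: Fh' cnt sd dR0; move: (\sum_i (Yt i ^+ 2 <= t / 2)%R%:R)
    (2 * sigma ^+ 2 / t * (d%:R * (1 + U))) => a b.
  by move: (d%:R) (s%:R) => x z; lra.
have : 4^-1 <= 2 * sigma ^+ 2 / t * (1 + U).
  by rewrite -(ler_pM2r dR0); apply: le_trans h _; rewrite [leLHS]mulrCA mulrC.
rewrite mulrAC ler_pdivlMr//; lra.
Qed.

Let err_le r : 0 <= r -> r <= 10 * t -> `|r - sigma ^+ 2| / sigma ^+ 2 <= 81 + 80 * U.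
Proof.
move=> r0 rt; rewrite ler_pdivrMr//.
have : `|r - sigma ^+ 2| <= r + sigma ^+ 2.
  by rewrite (le_trans (ler_normB _ _))// ger0_norm// ger0_norm// ltW.
have := t_hat_le; have := sg0; move: (sigma ^+ 2) => g g0 h1 h2; lra.
Qed.

(** Too many small xi_i^2 could push [t_hat] below y0 sigma^2; an empirical c.d.f. reaching F(2y) at
    a level y could push 2 sigma_S^2 below sigma^2. *)
Let B := fun y0 J => (2^-1 * d%:R <= \sum_i (xi i ^+ 2 <= y0)%R%:R + s%:R :> R) \/
  (exists y, [/\ y0 <= y, y <= y0 * (6 / 5) ^+ J &
    F (2 * y) * d%:R <= \sum_i (xi i ^+ 2 <= y)%R%:R + s%:R]).

Variables (q : R) (l1 : int).
Hypotheses (q0 : 0 <= q) (Bq : B (3 / 16) 28 -> 1 <= q).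
Hypotheses (l1l : 3 / 16 * sigma ^+ 2 <= 2 ^ l1) (l1u : 2 ^ l1 < 2 * (3 / 16 * sigma ^+ 2)).

(** The possible frequencies of the estimator, free of the data. Seven suffice because 2^7 * 3/16 =
    24 exceeds 16. *)
Let u (k : 'I_7) := Num.sqrt (lam / 2 ^ (l1 + k%:Z)).
Let D k := (\sum_i (cos (u k * mu i + u k * sigma * xi i) -
  cos (u k * mu i) * expR (- (u k * sigma) ^+ 2 / 2))) / d%:R.

Lemma pointwise_error : exists r : R, sigmaD2_hat s fro Yt = r%:E /\
  `|r - sigma ^+ 2| / sigma ^+ 2 <=
  800 * (U ^+ 2 + q + s%:R / (d%:R * L) + \sum_k `|D k| * expR ((u k * sigma) ^+ 2 / 2)).
Proof.
have [r [rE r0 rt]] := sigmaD2_hat_bound Yt d0 s fro.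
have e1 := err_le r0 rt.
have sL0 : 0 <= s%:R / (d%:R * L) by rewrite divr_ge0// mulr_ge0// (le_trans ler01).
have SD0 : 0 <= \sum_k `|D k| * expR ((u k * sigma) ^+ 2 / 2).
  by apply: sumr_ge0 => k _; rewrite mulr_ge0// expR_ge0.
have U20 := sqr_ge0 U.
(* For U > 1 the crude bound is already enough, as 81 + 80 U <= 161 U^2. *)
have [U1|U1] := leP U 1; last first.
  exists r; split => //; apply: le_trans e1 _.
  move: U20 q0 sL0 SD0; set a := s%:R / _; set b := \sum_k _ => U20 q0' a0 b0.
  by rewrite expr2 in U20 *; nra.
have e2 : `|r - sigma ^+ 2| / sigma ^+ 2 <= 161 by apply: le_trans e1 _; lra.
have [bad|good] := pselect (B (3 / 16) 28).
  exists r; split => //; apply: le_trans e2 _.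
  have := Bq bad; move: U20 sL0 SD0; set a := s%:R / _; set b := \sum_k _; lra.
have t16 : t <= 16 * sigma ^+ 2.
  have := t_hat_le; have := sg0; move: (sigma ^+ 2) => g g0 h; nra.
have tlo : 3 / 16 * sigma ^+ 2 <= t.
  rewrite leNgt; apply/negP => tl; apply: good; left.
  have := Fhat_gt_t_hat d0 tl; rewrite -(ler_pM2r dR0) FhatM => h.
  apply: le_trans h _; apply: le_trans (count_le _) _.
  by rewrite mulfK ?gt_eqF.
have t0 : 0 < t by apply: lt_le_trans tlo; rewrite mulr_gt0.
have [l [tl Ft _]] := t_hatP d0 t0.
rewrite -/t in tl Ft.
have FF : Fhat Yt t < F (2 * t / sigma ^+ 2).
  rewrite ltNge; apply/negP => h; apply: good; right.
  exists (t / sigma ^+ 2); split.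
  - by rewrite ler_pdivlMr.
  - rewrite ler_pdivrMr//.
    (* As (6/5)^4 > 2, the 28 grid steps cover a factor 128, while the range of [t] requires only
       16/(3/16) < 86. *)
    have : 2 ^+ 7 <= (6 / 5) ^+ 28 :> R.
      rewrite (_ : (6 / 5) ^+ 28 = ((6 / 5) ^+ 4) ^+ 7 :> R); last by rewrite -exprM.
      by rewrite lerXn2r ?nnegrE ?exprn_ge0//; lra.
    rewrite (_ : 2 ^+ 7 = 128 :> R); last by ring.
    move: ((6 / 5) ^+ 28) => z z0; move: t16 sg0; move: (sigma ^+ 2) => g tg g0; nra.
  - rewrite mulrA; apply: le_trans (count_le _); rewrite -FhatM.
    by rewrite ler_wpM2r// ltW.
have [k kE] : exists k : 'I_7, t = 2 ^ (l1 + k%:Z).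
  have ll : l1 <= l.
    rewrite leNgt; apply/negP => lt.
    have : 2 ^ (l + 1) <= 2 ^ l1 :> R by rewrite ler_eXz2l ?ltr1n// lezD1.
    rewrite expfzDr// expr1z -tl => h.
    by move: h l1u tlo; move: (2 ^ l1) (t) (sigma ^+ 2) => X z g; lra.
  have lu : l < l1 + 7%:Z.
    rewrite ltNge; apply/negP => le.
    have : 2 ^ (l1 + 7%:Z) <= 2 ^ l :> R by rewrite ler_eXz2l ?ltr1n.
    rewrite expfzDr// -tl -exprnP (_ : 2 ^+ 7 = 128 :> R); last by ring.
    move=> h; move: h l1l t16 sg0; move: (2 ^ l1) (t) (sigma ^+ 2) => X z g; lra.
  have kl : (absz (l - l1) < 7)%N.
    by rewrite -ltz_nat gez0_abs ?subr_ge0// ltrBlDl.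
  exists (Ordinal kl); rewrite /= gez0_abs ?subr_ge0// addrCA subrr addr0.
  exact: tl.
have uE : u k = Num.sqrt (lam / t) by rewrite /u -kE.
have lam0 : 0 < lam by rewrite lamE divr_gt0// (lt_le_trans ltr01).
have u2 : (u k * sigma) ^+ 2 = lam / t * sigma ^+ 2.
  by rewrite uE exprMn sqr_sqrtr// divr_ge0// ltW.
set v := (u k * sigma) ^+ 2 in u2.
(* [kap] is the relative bias caused by the perturbed coordinates, and [De] below is the noise
   amplified by exp(v/2): the empirical characteristic function is exp(-v/2) (1 + De - kap). *)
pose kap := (\sum_i (1 - cos (u k * mu i))) / d%:R.
have kap0 : 0 <= kap.
  rewrite divr_ge0// sumr_ge0// => i _; rewrite subr_ge0; exact: cos_le1.
have kaps : kap <= 2 * s%:R / d%:R.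
  rewrite ler_pM2r ?invr_gt0//; apply: (@le_trans _ _ (2 * \sum_i (mu i != 0)%:R)); last first.
    by rewrite ler_pM2l.
  rewrite mulr_sumr; apply: ler_sum => i _; have [->|_] := eqVneq (mu i) 0.
    by rewrite mulr0 cos0 subrr mulr0.
  by rewrite mulr1; have := cos_geN1 (u k * mu i); lra.
have kap8 : kap <= 8^-1.
  apply: le_trans kaps _; rewrite ler_pdivrMr//.
  by move: sd; move: (d%:R) (s%:R) => x z; lra.
pose De := D k * expR (v / 2).
have ee : expR (- v / 2) * expR (v / 2) = 1 by rewrite -expRD mulNr addNr expR0.
have phE : phi_hat Yt (Num.sqrt (lam / t)) =
    expR (- (lam / t * sigma ^+ 2) / 2) * (1 + (De - kap)).
  rewrite -u2 -uE /De.
  have -> : expR (- v / 2) * (1 + (D k * expR (v / 2) - kap)) =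
      expR (- v / 2) * (1 - kap) + D k * (expR (- v / 2) * expR (v / 2)) by ring.
  rewrite ee mulr1 /D -/v /phi_hat sumrB -mulr_suml /kap sumrB sumr_const card_ord.
  rewrite (eq_bigr (fun i => cos (u k * mu i + u k * sigma * xi i))); last first.
    by move=> i _; rewrite /Yt mulrDr mulrA.
  by rewrite -mulr_natr mul1r; field; rewrite gt_eqF.
have Dk : `|De| <= \sum_k `|D k| * expR ((u k * sigma) ^+ 2 / 2).
  rewrite /De normrM (gtr0_norm (expR_gt0 _)) (bigD1 k)//= -/v lerDl.
  by apply: sumr_ge0 => j _; rewrite mulr_ge0// expR_ge0.
(* A relative error above 1/4 pays for the crude bound 161, since 4 * 161 <= 800. *)
have [D4|D4] := leP `|De| 4^-1; last first.
  exists r; split => //; apply: le_trans e2 _.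
  by move: U20 q0 sL0 Dk; set a := s%:R / _; set b := \sum_k _; lra.
have yk : `|De - kap| <= `|De| + kap.
  by rewrite (le_trans (ler_normB _ _))// (ger0_norm kap0).
have y2 : `|De - kap| <= 2^-1 by apply: le_trans yk _; lra.
have [r' [r'E r'b]] := sigmaD2_hat_good d0 t0 sg0 FF y2 phE.
exists r'; split => //; rewrite ler_pdivrMr//; apply: le_trans r'b _.
(* 384 = 4 * 16 * 6. The factor 1/L, coming from lambda, turns the bias s/d into s/(d L). *)
have tl4 : 4 * t / lam <= 384 * sigma ^+ 2 / L.
  rewrite ler_pdivrMr// lamE (_ : 384 * sigma ^+ 2 / L * (L / 6) = 64 * sigma ^+ 2); last first.
    by field; rewrite gt_eqF// (lt_le_trans ltr01).
  by lra.
apply: (@le_trans _ _ (384 * sigma ^+ 2 / L * (`|De| + 2 * s%:R / d%:R))).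
  have tl0 : 0 <= 4 * t / lam.
    by apply: divr_ge0; [rewrite mulr_ge0// ltW|exact: ltW].
  rewrite -/t -/lam; apply: ler_pM => //.
  by apply: le_trans yk _; rewrite lerD2l.
have Li : 0 < L^-1 <= 1.
  by rewrite invr_gt0 (lt_le_trans ltr01)//= invf_le1// (lt_le_trans ltr01).
have -> : 384 * sigma ^+ 2 / L * (`|De| + 2 * s%:R / d%:R) =
   sigma ^+ 2 * (384 * (L^-1 * `|De|) + 768 * (s%:R / (d%:R * L))).
  by field; rewrite !gt_eqF// (lt_le_trans ltr01).
rewrite mulrC ler_pM2r//.
have : L^-1 * `|De| <= `|De| by rewrite ler_piMl//; case/andP: Li.
by move: U20 q0 sL0 Dk SD0; set a := s%:R / _; set b := \sum_k _; lra.
Qed.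

End pointwise.

(** [V] may be unbounded, so its integral is kept in the extended reals; the bounded [H] goes
    through real integrals. *)
Lemma integral_lincomb_le dT (T : measurableType dT) (R : realType)
    (P : probability T R) (a b v h : R) (V H : T -> R) :
  0 <= a -> 0 <= b -> measurable_fun setT V -> (forall w, 0 <= V w) ->
  bounded_measurable H -> (forall w, 0 <= H w) ->
  (\int[P]_w (V w)%:E <= v%:E)%E -> \int[P]_w H w <= h ->
  (\int[P]_w (a * V w + b * H w)%:E <= (a * v + b * h)%:E)%E.
Proof.
move=> a0 b0 mV V0 bH H0 EV EH.
have mH := bH.1.
under eq_integral do rewrite EFinD.
rewrite ge0_integralD//; last 4 first.
- by move=> w _; rewrite lee_fin mulr_ge0.
- exact/measurable_EFinP/measurable_funM.
- by move=> w _; rewrite lee_fin mulr_ge0.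
- exact/measurable_EFinP/measurable_funM.
rewrite EFinD; apply: leeD.
  under eq_integral do rewrite EFinM.
  rewrite ge0_integralZl//; last 2 first.
  - exact/measurable_EFinP.
  - by move=> w _; rewrite lee_fin.
  by rewrite EFinM lee_wpmul2l// lee_fin.
have bbH : bounded_measurable (fun w => b * H w).
  by apply: bounded_measurableM => //; exact: bounded_measurable_cst.
have fin := integrable_fin_num measurableT (bounded_measurable_integrable P bbH).
rewrite -(fineK fin) lee_fin -/(Rintegral P setT (fun w => b * H w)) RintegralZl//.
  by rewrite ler_wpM2l.
exact: bounded_measurable_integrable.
Qed.

(** * Integration of the pointwise bound *)

Section risk.
Variable R : realType.
Local Notation F := (@chi2_1_cdf R).

Let bad d (x : 'I_d -> R) (nu : R) :=
  (2^-1 * d%:R <= \sum_i (x i ^+ 2 <= 3 / 16)%R%:R + nu) \/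
  (exists y, [/\ 3 / 16 <= y, y <= 3 / 16 * (6 / 5) ^+ 28 &
    F (2 * y) * d%:R <= \sum_i (x i ^+ 2 <= y)%R%:R + nu]).

Let detectable_bad : detectable bad.
Proof.
apply: detectableU; last by apply: detectable_window; rewrite divr_gt0.
apply: (@detectable_small _ (3 / 16) 5^-1); [lra|lra|].
by have := chi2_1_cdf_fifth R; lra.
Qed.

Lemma deconvolution_risk : exists C c : R, 0 < C /\ 0 < c /\
  forall (d s : nat) (sigma fro : R) (mu : 'I_d -> R)
    (dT : measure_display) (T : measurableType dT) (P : probability T R)
    (xi : 'I_d -> T -> R) (rho : 'I_d -> 'I_d -> R),
  (0 < d)%N -> (0 < s)%N -> s%:R <= c * d%:R -> 0 < sigma ->
  (#|[pred i | mu i != 0%R]| <= s)%N ->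
  gaussian_pairs P xi rho -> 0 < fro -> fro <= d%:R ->
  \sum_i \sum_k rho i k ^+ 2 = fro ^+ 2 ->
  (\int[P]_w (`| sigmaD2_hat s fro (fun i => (mu i + sigma * xi i w)%R) - (sigma ^+ 2)%:E |
     * (sigma ^- 2)%:E)
   <= (C * (s%:R / (d%:R * Num.max 1 (ln (s%:R / fro))) + fro / d%:R))%:E)%E.
Proof.
have [c1 [K [q [c10 K0 q0 badq Eq]]]] := detectable_bad.
have [C2 [C20 rate]] := variance_rate R.
exists (800 * (2 + K + 1 + 7 * (1 + C2))), (Num.min c1 16^-1).
have Cpos : 0 < 2 + K + 1 + 7 * (1 + C2) by lra.
split; first by rewrite mulr_gt0 ?ltr0n.
split; first by rewrite lt_min c10/= invr_gt0.
move=> d s sigma fro mu dT T P xi rho d0 s0 scd sigma0 mus G fro0 frod rhofro.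
have [mxi _ _] := G.
have dR0 : 0 < d%:R :> R by rewrite ltr0n.
have sR0 : 0 < s%:R :> R by rewrite ltr0n.
have sc1 : s%:R <= c1 * d%:R :> R by apply: le_trans scd _; rewrite ler_wpM2r// ge_min lexx.
have s16 : s%:R <= 16^-1 * d%:R :> R by apply: le_trans scd _; rewrite ler_wpM2r// ge_min lexx orbT.
have sg0 : 0 < sigma ^+ 2 by rewrite exprn_gt0.
have x0 : 0 < 3 / 16 * sigma ^+ 2 by rewrite mulr_gt0// divr_gt0.
have [l1 [l1l l1u]] := dyadic_between x0.
set L := Num.max 1 (ln (s%:R / fro)).
have L1 : 1 <= L by rewrite le_max lexx.
have L0 : 0 < L by exact: lt_le_trans L1.
pose r := s%:R / (d%:R * L) + fro / d%:R; rewrite -/r.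
have r0 : 0 < r by rewrite addr_gt0// divr_gt0// mulr_gt0.
pose lam := lambda_D s fro.
have lamE : lam = L / 6 by [].
pose u (k : 'I_7) := Num.sqrt (lam / 2 ^ (l1 + k%:Z)).
pose S k w := \sum_i (cos (u k * mu i + u k * sigma * xi i w) -
  cos (u k * mu i) * expR (- (u k * sigma) ^+ 2 / 2)).
pose V w := (\sum_i (xi i w ^+ 2 - 1)) ^+ 2.
pose e k := expR ((u k * sigma) ^+ 2).
(* Each amplified error is replaced by r plus its square over r, and the first [r] majorizes s/(d
   L); thus only second moments are integrated. *)
pose H w := q d (xi^~ w) + (r + \sum_k (r + e k / (r * d%:R ^+ 2) * (S k w * S k w))).
have bS k : bounded_measurable (S k).
  apply: bounded_measurable_sum => i.
  apply: bounded_measurableB; last exact: bounded_measurable_cst.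
  by apply: bounded_measurable_cos; apply: measurable_funD => //; exact: measurable_funM.
have bc (z : R) : bounded_measurable (fun _ : T => z) by exact: bounded_measurable_cst.
have bS2 k : bounded_measurable (fun w => S k w * S k w) by exact: bounded_measurableM.
have bSk k : bounded_measurable (fun w => e k / (r * d%:R ^+ 2) * (S k w * S k w)).
  exact: (bounded_measurableM (bc _) (bS2 k)).
have bSr k : bounded_measurable (fun w => r + e k / (r * d%:R ^+ 2) * (S k w * S k w)).
  exact: (bounded_measurableD (bc _) (bSk k)).
have bsum : bounded_measurable (fun w => \sum_k (r + e k / (r * d%:R ^+ 2) * (S k w * S k w))).
  exact: bounded_measurable_sum.
have [bq Eqq] := Eq _ _ _ _ _ _ G.
have bH2 := bounded_measurableD (bc r) bsum.
have bH : bounded_measurable H by exact: (bounded_measurableD bq bH2).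
have V0 w : 0 <= V w by exact: sqr_ge0.
have e0 k : 0 < e k by exact: expR_gt0.
have H0 w : 0 <= H w.
  apply: addr_ge0 => //; apply: addr_ge0; first exact: ltW.
  apply: sumr_ge0 => k _; apply: addr_ge0; first exact: ltW.
  rewrite -expr2 mulr_ge0 ?sqr_ge0// divr_ge0 ?(ltW (e0 k))//.
  by rewrite mulr_ge0 ?sqr_ge0// ltW.
have mV : measurable_fun setT V.
  apply: measurable_funX; apply: measurable_sum => i.
  by apply: measurable_funB => //; exact: measurable_funX.
pose D w := 800 / d%:R ^+ 2 * V w + 800 * H w.
have d2 : 0 < d%:R ^+ 2 :> R by rewrite exprn_gt0.
have ptw w : (`| sigmaD2_hat s fro (fun i => (mu i + sigma * xi i w)%R) - (sigma ^+ 2)%:E |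
     * (sigma ^- 2)%:E <= (D w)%:E)%E.
  have bq1 : bad (xi^~ w) s%:R -> 1 <= q d (xi^~ w) by exact: badq.
  have [z [-> zb]] := pointwise_error fro d0 sigma0 mus s16 (q0 d (xi^~ w)) bq1 l1l l1u.
  rewrite -EFinB abse_EFin -EFinM lee_fin; apply: le_trans zb _.
  have -> : D w = 800 * (((\sum_i (xi i w ^+ 2 - 1)) / d%:R) ^+ 2 + H w).
    by rewrite /D /V; field; rewrite gt_eqF.
  rewrite ler_pM2l ?ltr0n// -!addrA lerD2l lerD2l.
  apply: lerD; first by rewrite /r -/L lerDl divr_ge0// ltW.
  apply: ler_sum => k _.
  rewrite -/(u k) -/(S k w).
  set h := expR ((u k * sigma) ^+ 2 / 2); have h0 : 0 <= h by exact: expR_ge0.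
  have -> : e k = h ^+ 2 by rewrite /h -expRM_natl; congr expR; field.
  rewrite normrM normfV (gtr0_norm dR0).
  rewrite -expr2 -(real_normK (num_real (S k w))).
  move: `|S k w| (normr_ge0 (S k w)) => x xx0.
  (* AM-GM *)
  have sq := sqr_ge0 (r - x / d%:R * h).
  rewrite -(ler_pM2l r0) mulrDr.
  have -> : r * (h ^+ 2 / (r * d%:R ^+ 2) * x ^+ 2) = (x / d%:R * h) ^+ 2.
    by field; rewrite !gt_eqF.
  have p0 : 0 <= x / d%:R * h by rewrite mulr_ge0// divr_ge0// ltW.
  by move: sq p0; move: (x / d%:R * h) => z1; nra.
have f0 w : (0 <= `| sigmaD2_hat s fro (fun i => (mu i + sigma * xi i w)%R) - (sigma ^+ 2)%:E |
     * (sigma ^- 2)%:E)%E.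
  by rewrite mule_ge0// lee_fin invr_ge0 ltW.
have mD : measurable_fun setT (EFin \o D).
  apply/measurable_EFinP; apply: measurable_funD; apply: measurable_funM => //.
  exact: bH.1.
apply: le_trans (integral_le_measurable P f0 ptw mD) _.
have m0 : 0 <= 800 :> R by rewrite ler0n.
have c80 : 0 <= 800 / d%:R ^+ 2 :> R by exact: divr_ge0 m0 (ltW d2).
(* As F/d <= 1, the bad events, of mean O(F^2/d^2), are within the rate. *)
have fd1 : fro ^+ 2 / d%:R ^+ 2 <= r.
  have fd : 0 <= fro / d%:R <= 1.
    by rewrite divr_ge0 ?(ltW fro0) ?(ltW dR0)//= ler_pdivrMr// mul1r.
  apply: (@le_trans _ _ (fro / d%:R)).
    rewrite -expr_div_n expr2; case/andP: fd => fd0 fd1.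
    by rewrite ler_piMr.
  by rewrite /r lerDr divr_ge0// mulr_ge0// ltW.
have EV : (\int[P]_w (V w)%:E <= (2 * fro ^+ 2)%:E)%E.
  by have := second_moment_sqr_sum G; rewrite rhofro.
have ES k : e k / (r * d%:R ^+ 2) * \int[P]_w (S k w * S k w) <= C2 * r.
  have als : #|[pred i | u k * mu i != 0]|%:R <= s%:R :> R.
    rewrite ler_nat (leq_trans _ mus)//; apply: subset_leq_card.
    apply/fintype.subsetP => i; rewrite !inE; apply: contraNN => /eqP ->.
    by rewrite mulr0.
  have := second_moment_cos_sparse G (u k * sigma) fro0 sR0 rhofro als.
  under eq_Rintegral do rewrite -/(S k _) expr2.
  move=> hS.
  have tk : 3 / 16 * sigma ^+ 2 <= 2 ^ (l1 + k%:Z).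
    apply: le_trans l1l _; rewrite ler_eXz2l ?ltr1n//.
    by rewrite lerDl.
  have tk0 : 0 < 2 ^ (l1 + k%:Z) :> R by exact: lt_le_trans tk.
  have vE : (u k * sigma) ^+ 2 = lam / 2 ^ (l1 + k%:Z) * sigma ^+ 2.
    rewrite /u exprMn sqr_sqrtr//; apply: divr_ge0; last exact: ltW.
    by rewrite lamE divr_ge0// ltW.
  (* lambda = L/6 and a dyadic number at least 3/16 sigma^2 give v <= (L/6)(16/3) = 8L/9. *)
  have vL : (u k * sigma) ^+ 2 <= 8 / 9 * L.
    rewrite vE lamE mulrAC ler_pdivrMr//.
    by have := ler_wpM2l (ltW L0) tk; lra.
  have := rate _ _ _ sR0 fro0 (sqr_ge0 (u k * sigma)) vL.
  rewrite -/(e k) -exprM => hr.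
  have rE : s%:R / L + fro = r * d%:R by rewrite /r; field; rewrite !gt_eqF.
  rewrite -/L rE in hr.
  rewrite mulrAC ler_pdivrMr; last by rewrite mulr_gt0.
  apply: le_trans (ler_wpM2l (ltW (e0 k)) hS) _; apply: le_trans hr _.
  by rewrite le_eqVlt; apply/orP; left; apply/eqP; ring.
have EH : \int[P]_w H w <= (K + 1 + 7 * (1 + C2)) * r.
  rewrite RintegralD//; [|exact: bounded_measurable_integrable..].
  rewrite RintegralD//; [|exact: bounded_measurable_integrable..].
  have P1 (z : R) : \int[P]_w z = z.
    rewrite Rintegral_cst// (_ : fine (P setT) = 1) ?mulr1//.
    by rewrite -[RHS]/(fine 1%E); congr fine; exact: probability_setT.
  rewrite P1 Rintegral_bounded_sum//.
  have sum7 : \sum_(k < 7) \int[P]_w (r + e k / (r * d%:R ^+ 2) * (S k w * S k w)) <= 7 * ((1 + C2) * r).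
    rewrite (_ : 7 * ((1 + C2) * r) = \sum_(k < 7) ((1 + C2) * r)); last first.
      by rewrite sumr_const card_ord mulr_natl.
    apply: ler_sum => k _.
    rewrite RintegralD//; [|exact: bounded_measurable_integrable..].
    rewrite P1 RintegralZl//; last exact: bounded_measurable_integrable.
    rewrite [leRHS](_ : _ = r + C2 * r); last by ring.
    by rewrite lerD2l; exact: ES.
  have Eq1 : \int[P]_w q d (xi^~ w) <= K * r.
    apply: le_trans Eqq _; rewrite rhofro -mulrA ler_wpM2l//.
  by move: sum7 Eq1; move: (\int[P]_w _) (\sum_(k < 7) _) => a b; lra.
apply: le_trans (integral_lincomb_le c80 m0 mV V0 bH H0 EV EH) _.
rewrite lee_fin.
have -> : 800 / d%:R ^+ 2 * (2 * fro ^+ 2) = 1600 * (fro ^+ 2 / d%:R ^+ 2) by ring.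
by move: fd1; move: (fro ^+ 2 / _) => a; lra.
Qed.

End risk.

(* Y = theta + sigma * eps with eps = A Z, Z a vector of iid N(0,1) variables,
   so that eps ~ N(0, Sigma) with Sigma = A A^T (every covariance matrix arises so). *)
Theorem theorem6 (R : realType) :
  exists C c : R, 0 < C /\ 0 < c /\
  forall (d s : nat) (sigma cstar : R) (theta : 'I_d -> R) (A : 'M[R]_d)
    (dT : measure_display) (T : measurableType dT) (P : probability T R)
    (Z : 'I_d -> T -> R),
    (1 <= d)%N -> (1 <= s)%N -> s%:R <= c * d%:R ->
    0 < sigma ->
    (#|[set i : 'I_d | theta i != 0%R]| <= s)%N ->
    0 < cstar -> (forall i, cstar <= (A *m A^T) i i) ->
    (forall i, measurable_fun setT (Z i)) ->
    (forall i (B : set R), measurable B -> P (Z i @^-1` B) = normal_prob 0 1 B) ->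
    mutually_independent P Z ->
    let Sigma := A *m A^T in
    let fro := normalized_frob Sigma in
    let Yt := fun w (i : 'I_d) =>
      (theta i + sigma * \sum_(j < d) A i j * Z j w) / Num.sqrt (Sigma i i) in
    (\int[P]_w (`| sigmaD2_hat s fro (Yt w) - (sigma ^+ 2)%:E | * (sigma ^- 2)%:E)
      <= (C * (s%:R / (d%:R * Num.max 1 (ln (s%:R / fro))) + fro / d%:R))%:E)%E.
Proof.
have [C [c [C0 [c0 risk]]]] := deconvolution_risk R.
exists C, c; split => //; split => //.
move=> d s sigma cstar theta A dT T P Z d1 s1 scd sigma0 ths cs0 csA mZ lawZ indZ.
cbv beta zeta; set Sigma := A *m A^T in csA *; set fro := normalized_frob Sigma.
have Sii i : 0 < Sigma i i by exact: lt_le_trans (csA i).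
pose sd i := Num.sqrt (Sigma i i).
have sd0 i : 0 < sd i by rewrite sqrtr_gt0.
have sd2 i : sd i * sd i = Sigma i i by rewrite -expr2 sqr_sqrtr// ltW.
have SigE i k : Sigma i k = \sum_j A i j * A k j.
  by rewrite /Sigma mxE; apply: eq_bigr => j _; rewrite mxE.
(* Dividing each row of [A] by its standard deviation yields unit rows, whose inner products are the
   entries of the normalized covariance; the same division of theta does not enlarge its support. *)
pose a i j := A i j / sd i.
pose rho i k := \sum_j a i j * a k j.
have rhoE i k : rho i k = Sigma i k / (sd i * sd k).
  rewrite SigE mulr_suml; apply: eq_bigr => j _.
  by rewrite /a; field; rewrite !gt_eqF.
have rho1 i : rho i i = 1 by rewrite rhoE sd2 divff// gt_eqF.
have a1 i : \sum_j a i j ^+ 2 = 1.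
  by rewrite -(rho1 i); apply: eq_bigr => j _; rewrite expr2.
have G := gaussian_pairs_lin mZ lawZ indZ a1.
have rho_ge0 : 0 <= \sum_i \sum_k rho i k ^+ 2.
  by apply: sumr_ge0 => i _; apply: sumr_ge0 => k _; exact: sqr_ge0.
have froE : fro = Num.sqrt (\sum_i \sum_k rho i k ^+ 2).
  congr Num.sqrt; apply: eq_bigr => i _; apply: eq_bigr => k _.
  by rewrite rhoE.
have fro2 : \sum_i \sum_k rho i k ^+ 2 = fro ^+ 2 by rewrite froE sqr_sqrtr.
have fro0 : 0 < fro.
  pose i0 := Ordinal d1.
  rewrite froE sqrtr_gt0 (bigD1 i0)//= ltr_pwDl//; last first.
    by apply: sumr_ge0 => i _; apply: sumr_ge0 => k _; exact: sqr_ge0.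
  rewrite (bigD1 i0)//= rho1 expr1n ltr_pwDl// sumr_ge0// => k _.
  exact: sqr_ge0.
have frod : fro <= d%:R.
  rewrite -ler_sqr ?nnegrE ?(ltW fro0)// -fro2.
  apply: (@le_trans _ _ (\sum_(i < d) \sum_(k < d) 1)).
    apply: ler_sum => i _; apply: ler_sum => k _.
    have [_ /(_ i k) rle _] := G.
    by rewrite -(real_normK (num_real _)) exprn_ile1.
  under eq_bigr do rewrite sumr_const card_ord.
  by rewrite sumr_const card_ord expr2 mulr_natr.
pose mu i := theta i / sd i.
have mus : (#|[pred i | mu i != 0%R]| <= s)%N.
  move: ths; rewrite (card_classical_set (fun i => theta i != 0)); apply: leq_trans.
  apply: subset_leq_card; apply/fintype.subsetP => i; rewrite !inE.
  by apply: contraNN => /eqP ti; rewrite /mu ti mul0r.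
have YtE w : (fun i => (theta i + sigma * \sum_(j < d) A i j * Z j w) / Num.sqrt (Sigma i i)) =
    (fun i => mu i + sigma * \sum_j a i j * Z j w).
  apply/funext => i; rewrite mulrDl -/(sd i) -/(mu i) -mulrA; congr (_ + _ * _).
  by rewrite mulr_suml; apply: eq_bigr => j _; rewrite /a mulrAC.
under eq_integral do rewrite YtE.
exact: (risk d s sigma fro mu _ _ _ _ _ d1 s1 scd sigma0 mus G fro0 frod fro2).
Qed.
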